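(* Let $\lambda=(\lambda_n)_{n\in\mathbb N}$ be a sequence of bilinear maps (satisfying the standing conditions listed in the context) that satisfies (O1), (O2) and (O3). Then the mapping sending each pair $(\mathcal S,\mathcal T)$ of operator systems to $\mathcal S\otimes_\lambda\mathcal T:=(\mathcal S\otimes\mathcal T,\{\mathcal C_n^\lambda\}_{n=1}^\infty,1_{\mathcal S}\otimes1_{\mathcal T})$ is an operator system tensor product.
   Context: **Matrices.** $M_{k,l}$ denotes the complex $k\times l$ matrices with operator norm, $M_k=M_{k,k}$, and $M_{k,l}(W)=M_{k,l}\otimes W$ for a vector space $W$. $\varepsilon^{[k]}_{i,j}\in M_k$ is the matrix unit with $1$ in position $(i,j)$, with the convention $\varepsilon^{[k]}_{i,j}=0$ if $(i,j)\notin\{1,\dots,k\}^2$; $\varepsilon^{[k]}_j=\varepsilon^{[k]}_{j,j}$. $I_p$ is the identity of $M_p$. **$\lambda$-theory (bilinear case $m=2$).** $\lambda=(\lambda_k)_{k\in\mathbb N}$ is a sequence of bilinear maps $\lambda_k:M_k\times M_k\to M_{\tau(k)}$ with $\tau(k)\in\mathbb N$; $\|\lambda_k\|$ is its norm as a bounded bilinear map. For vector spaces $V_1,V_2$, $\otimes_{\lambda_k}:M_k(V_1)\times M_k(V_2)\to M_{\tau(k)}(V_1\otimes V_2)$ is the bilinear map with $\otimes_{\lambda_k}(\alpha_1\otimes v_1,\alpha_2\otimes v_2)=\lambda_k(\alpha_1,\alpha_2)\otimes v_1\otimes v_2$. **Standing conditions on $\lambda$.** (N1) $\tau(1)=1$.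 (N2) $\|\lambda_j\|=1$ for all $j$. (E1) For all $k$ there exist $p\in\mathbb N$, $S\in M_{k,\tau(p)}$, $T\in M_{\tau(p),k}$, $a_1,\dots,a_k\in M_p$ such that for all $j_1,j_2\in\{1,\dots,k\}$, $S\lambda_p(a_{j_1},a_{j_2})T=\varepsilon_j^{[k]}$ if $j_1=j_2=j$, and $=0$ otherwise. (E2) For all $r,s\in\mathbb N$ there is $P\in M_{\tau(r)+\tau(s),\tau(r+s)}$ with $\|P\|\le1$ such that for all $(i_1,j_1),(i_2,j_2)\in\{1,\dots,r\}^2\cup\{r+1,\dots,r+s\}^2$, $P\lambda_{r+s}(\varepsilon^{[r+s]}_{i_1,j_1},\varepsilon^{[r+s]}_{i_2,j_2})P^*=\mathrm{diag}\big(\lambda_r(\varepsilon^{[r]}_{i_1,j_1},\varepsilon^{[r]}_{i_2,j_2}),\lambda_s(\varepsilon^{[s]}_{i_1-r,j_1-r},\varepsilon^{[s]}_{i_2-r,j_2-r})\big).$ (E3) $\lambda_1(1,1)=1$ and $\sup_k\|\lambda_k\|<\infty$. (W1) For all $\gamma\in M_p$ there are $P\in M_{p,\tau(p)}$, $Q\in M_{\tau(p),p}$ with $\|P\|,\|Q\|\le1$ and $\gamma=P\lambda_p(\gamma,I_p)Q$; likewise with $\lambda_p(I_p,\gamma)$. (W2) For all $\alpha_1,\alpha_2\in M_p$, $\beta_1,\beta_2\in M_q$ there are $S\in M_{\tau(p)\tau(q),\tau(pq)}$, $T\in M_{\tau(pq),\tau(p)\tau(q)}$ with $\|S\|,\|T\|\le1$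 and $\lambda_p(\alpha_1,\alpha_2)\otimes\lambda_q(\beta_1,\beta_2)=S\lambda_{pq}(\alpha_1\otimes\beta_1,\alpha_2\otimes\beta_2)T$. **Further conditions.** (O1) For each $r$ and all $(i_k,j_k)\in\{1,\dots,r\}^2$: $\lambda_r(\varepsilon^{[r]}_{i_1,j_1},\varepsilon^{[r]}_{i_2,j_2})=\lambda_r(\varepsilon^{[r]}_{j_1,i_1},\varepsilon^{[r]}_{j_2,i_2})^*$. (O2) For each $r$, the matrix $P\in M_{2\tau(r),\tau(2r)}$, $\|P\|\le1$, of (E2) with $s=r$ also satisfies, for all $(i_1,j_1),(i_2,j_2)\in R\cup S$, where $R=\{1,\dots,r\}\times\{r+1,\dots,2r\}$ and $S=\{r+1,\dots,2r\}\times\{1,\dots,r\}$, $$P\lambda_{2r}(\varepsilon^{[2r]}_{i_1,j_1},\varepsilon^{[2r]}_{i_2,j_2})P^*=\begin{pmatrix}0&\lambda_r(\varepsilon^{[r]}_{i_1,j_1-r},\varepsilon^{[r]}_{i_2,j_2-r})\\ \lambda_r(\varepsilon^{[r]}_{i_1-r,j_1},\varepsilon^{[r]}_{i_2-r,j_2})&0\end{pmatrix}.$$ (O3) For each $r$ and all $p_1,p_2\in\mathbb N$, the bilinear map $M_r(M_{p_1})\times M_r(M_{p_2})\to M_{\tau(r)}(M_{p_1p_2})$ obtained by tensorizing $\lambda_r$ with the Kronecker product, i.e. $(\beta_1\otimes\alpha_1,\beta_2\otimes\alpha_2)\mapsto\lambda_r(\beta_1,\beta_2)\otimes\alpha_1\otimes\alpha_2$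 for $\beta_i\in M_r$, $\alpha_i\in M_{p_i}$, is positive: it maps pairs of positive elements to positive elements. **Operator systems.** For a complex $*$-vector space $V$, $M_n(V)$ has the involution $[v_{ij}]^*=[v_{ji}^*]$. A matrix ordering on $V$ is a family $\{C_n\}$ of proper cones $C_n\subseteq M_n(V)_{sa}$ (so $C_n\cap(-C_n)=\{0\}$) with $A^*C_nA\subseteq C_k$ for all $A\in M_{n,k}$. An (abstract) operator system is a triple $(V,\{C_n\},e)$ with $\{C_n\}$ a matrix ordering and $e\in V_{sa}$ an Archimedean matrix order unit: with $e_n=\mathrm{diag}(e,\dots,e)$, for each $n$ and $v\in M_n(V)_{sa}$ there is $r>0$ with $re_n-v\in C_n$, and $se_n+v\in C_n$ for all $s>0$ implies $v\in C_n$. $\mathcal S\otimes\mathcal T$ (algebraic tensor product) carries the involution $(s\otimes t)^*=s^*\otimes t^*$. **The cones.** For operator systems $\mathcal S,\mathcal T$ with units $1_{\mathcal S},1_{\mathcal T}$, $$\mathcal C_n=\{\alpha\otimes_{\lambda_j}(s,t)\alpha^*: s\in M_j(\mathcal S)^+,\ t\in M_j(\mathcal T)^+,\ \alpha\in M_{n,\tau(j)},\ j\in\mathbb N\},$$ $$\mathcal C_n^\lambda=\{P\in M_n(\mathcal S\otimes\mathcal T): r(1_{\mathcal S}\otimes1_{\mathcal T})_n+P\in\mathcal C_n\ \text{for all } r>0\}.$$ **Operator system tensor product (Kavruk–Paulsen–Todorov–Tomforde).** A mapping assigning to each pair $(\mathcal S,\mathcal T)$ of operator systems a family of cones $D_n\subseteq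 M_n(\mathcal S\otimes\mathcal T)$ is an operator system tensor product if for all $\mathcal S,\mathcal T$: (T1) $(\mathcal S\otimes\mathcal T,\{D_n\},1_{\mathcal S}\otimes1_{\mathcal T})$ is an operator system; (T2) $P\otimes Q\in D_{kl}$ for all $P\in M_k(\mathcal S)^+$, $Q\in M_l(\mathcal T)^+$ and $k,l\in\mathbb N$; (T3) if $\phi:\mathcal S\to M_k$ and $\psi:\mathcal T\to M_l$ are unital completely positive, then $\phi\otimes\psi:\mathcal S\otimes\mathcal T\to M_{kl}$ is unital completely positive with respect to $\{D_n\}$. *)

(* Defs.v *)
From HB Require Import structures.
From mathcomp Require Import all_boot all_order all_algebra.
From mathcomp Require Import generic_quotient.
From mathcomp Require Import boolp classical_sets reals.
From mathcomp.real_closed Require Import complex mxtens.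

Set Implicit Arguments.
Unset Strict Implicit.
Unset Printing Implicit Defensive.

Import Order.TTheory GRing.Theory Num.Theory.

Local Open Scope ring_scope.
Local Open Scope quotient_scope.
Local Open Scope classical_set_scope.

Notation "A *t B" := (tensmx A B)
  (at level 40, left associativity, format "A  *t  B") : ring_scope.

(* Algebraic tensor product. A formal sum v1 (x) w1 + ... + vn (x) wn is the sequence of
   the pairs (vi, wi); the tensor product is the quotient of the formal sums by
   the least congruence that makes (x) bilinear. *)

Section TensorProduct.
Variables (K : comNzRingType) (V W : lmodType K).

Inductive tens_cong : seq (V * W) -> seq (V * W) -> Prop :=
| TensRefl s : tens_cong s s
| TensSym s t : tens_cong s t -> tens_cong t s
| TensTrans s t u : tens_cong s t -> tens_cong t u -> tens_cong s u
| TensCat s t s' t' :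
    tens_cong s s' -> tens_cong t t' -> tens_cong (s ++ t) (s' ++ t')
| TensSwap s t : tens_cong (s ++ t) (t ++ s)
| Tens0 w : tens_cong [:: (0, w)] [::]
| TensDl v v' w : tens_cong [:: (v + v', w)] [:: (v, w); (v', w)]
| TensDr v w w' : tens_cong [:: (v, w + w')] [:: (v, w); (v, w')]
| TensZ a v w : tens_cong [:: (a *: v, w)] [:: (v, a *: w)].

Definition tens_congb (s t : seq (V * W)) : bool := `[< tens_cong s t >].

Lemma tens_congb_refl : reflexive tens_congb.
Proof. by move=> s; apply/asboolP; exact: TensRefl. Qed.

Lemma tens_congb_sym : symmetric tens_congb.
Proof. by move=> s t; apply/asboolP/asboolP; exact: TensSym. Qed.

Lemma tens_congb_trans : transitive tens_congb.
Proof.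
by move=> t s u /asboolP st /asboolP tu; apply/asboolP; exact: TensTrans st tu.
Qed.

Canonical tens_congb_equiv :=
  EquivRel tens_congb tens_congb_refl tens_congb_sym tens_congb_trans.

Definition tensor := {eq_quot tens_congb}.

HB.instance Definition _ := Choice.on tensor.
HB.instance Definition _ := Quotient.on tensor.

Definition tens_class (s : seq (V * W)) : tensor := \pi_tensor s.

Lemma tens_classP s t : tens_class s = tens_class t <-> tens_cong s t.
Proof.
split=> [e|st].
  have /asboolP : tens_congb s t by apply/(eqmodP tens_congb_equiv).
  by [].
by apply/(eqmodP tens_congb_equiv)/asboolP.
Qed.

Lemma repr_tens_class s : tens_cong (repr (tens_class s)) s.
Proof. by apply/tens_classP; rewrite /tens_class reprK. Qed.

Lemma tens_classK (x : tensor) : tens_class (repr x) = x.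
Proof. by rewrite /tens_class reprK. Qed.

Definition tens_scale_seq (a : K) (s : seq (V * W)) :=
  [seq (a *: p.1, p.2) | p <- s].

Definition tens_zero : tensor := tens_class [::].
Definition tens_add (x y : tensor) : tensor := tens_class (repr x ++ repr y).
Definition tens_scale (a : K) (x : tensor) : tensor :=
  tens_class (tens_scale_seq a (repr x)).

Lemma tens_scale_cong a s t :
  tens_cong s t -> tens_cong (tens_scale_seq a s) (tens_scale_seq a t).
Proof.
elim=> {s t} [s|s t _ st|s t u _ st _ tu|s t s' t' _ ss _ tt|s t|w|v v' w
             |v w w'|b v w] //=.
- exact: TensRefl.
- exact: TensSym.
- exact: TensTrans st tu.
- by rewrite /tens_scale_seq !map_cat; exact: TensCat.
- by rewrite /tens_scale_seq !map_cat; exact: TensSwap.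
- by rewrite scaler0; exact: Tens0.
- by rewrite scalerDr; exact: TensDl.
- exact: TensDr.
- by rewrite scalerA mulrC -scalerA; exact: TensZ.
Qed.

Lemma tens_addE s t :
  tens_add (tens_class s) (tens_class t) = tens_class (s ++ t).
Proof. by apply/tens_classP/TensCat; exact: repr_tens_class. Qed.

Lemma tens_scaleE a s :
  tens_scale a (tens_class s) = tens_class (tens_scale_seq a s).
Proof. by apply/tens_classP/tens_scale_cong; exact: repr_tens_class. Qed.

Lemma tens_addA : associative tens_add.
Proof.
move=> x y z; rewrite -[x]tens_classK -[y]tens_classK -[z]tens_classK.
by rewrite !tens_addE catA.
Qed.

Lemma tens_addC : commutative tens_add.
Proof. by move=> x y; apply/tens_classP; exact: TensSwap. Qed.

Lemma tens_add0 : left_id tens_zero tens_add.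
Proof. by move=> x; rewrite -[x]tens_classK tens_addE. Qed.

Lemma tens_scale_map0 (s : seq (V * W)) : tens_cong [seq (0, p.2) | p <- s] [::].
Proof.
elim: s => [|p s IH] /=; first exact: TensRefl.
by apply: (@TensCat [:: (0, p.2)] _ [::] [::]) => //; exact: Tens0.
Qed.

Lemma tens_scaleDl_seq a b s :
  tens_cong (tens_scale_seq (a + b) s)
            (tens_scale_seq a s ++ tens_scale_seq b s).
Proof.
elim: s => [|[v w] s IH] /=; first exact: TensRefl.
apply: (@TensTrans _ ([:: (a *: v, w); (b *: v, w)]
          ++ (tens_scale_seq a s ++ tens_scale_seq b s))).
  apply: (@TensCat [:: ((a + b) *: v, w)]) => //.
  by rewrite scalerDl; exact: TensDl.
apply: (@TensCat [:: (a *: v, w)] _ [:: (a *: v, w)]); first exact: TensRefl.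
rewrite -[X in tens_cong X _]/([:: (b *: v, w)] ++ _) catA.
rewrite -[X in tens_cong _ (_ ++ X)]/([:: (b *: v, w)] ++ _) [X in tens_cong _ X]catA.
by apply: TensCat; [exact: TensSwap|exact: TensRefl].
Qed.

Lemma tens_addN : left_inverse tens_zero (tens_scale (- 1)) tens_add.
Proof.
move=> x; rewrite -[x]tens_classK tens_scaleE tens_addE; apply/tens_classP.
have e : repr x = tens_scale_seq 1 (repr x).
  by rewrite /tens_scale_seq -[LHS]map_id; apply: eq_map => -[v w] /=;
    rewrite scale1r.
rewrite [X in _ ++ X]e.
apply: TensTrans (TensSym (tens_scaleDl_seq _ _ _)) _.
rewrite addNr.
suff -> : tens_scale_seq 0 (repr x) = [seq (0, p.2) | p <- repr x].
  exact: tens_scale_map0.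
by apply: eq_map => p; rewrite scale0r.
Qed.

HB.instance Definition _ := GRing.isZmodule.Build tensor
  tens_addA tens_addC tens_add0 tens_addN.

Lemma tens_scaleA a b x : tens_scale a (tens_scale b x) = tens_scale (a * b) x.
Proof.
rewrite -[x]tens_classK !tens_scaleE /tens_scale_seq -map_comp.
by congr tens_class; apply: eq_map => p /=; rewrite scalerA.
Qed.

Lemma tens_scale1 : left_id 1 tens_scale.
Proof.
move=> x; rewrite -[x in RHS]tens_classK; congr tens_class.
by rewrite /tens_scale_seq -[RHS]map_id; apply: eq_map => -[v w] /=;
  rewrite scale1r.
Qed.

Lemma tens_scaleDr : right_distributive tens_scale +%R.
Proof.
move=> a x y; rewrite -[x]tens_classK -[y]tens_classK.
rewrite -[_ + _]/(tens_add _ _) -[RHS]/(tens_add _ _).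
by rewrite tens_addE !tens_scaleE tens_addE /tens_scale_seq map_cat.
Qed.

Lemma tens_scaleDl x : {morph tens_scale^~ x : a b / a + b}.
Proof.
move=> a b; rewrite -[x]tens_classK -[RHS]/(tens_add _ _) !tens_scaleE.
by rewrite tens_addE; apply/tens_classP; exact: tens_scaleDl_seq.
Qed.

HB.instance Definition _ := GRing.Zmodule_isLmodule.Build K tensor
  tens_scaleA tens_scale1 tens_scaleDr tens_scaleDl.

Definition tens (v : V) (w : W) : tensor := tens_class [:: (v, w)].

Lemma tens_class_cons p s : tens_class (p :: s) = tens p.1 p.2 + tens_class s.
Proof. by case: p => v w; rewrite -[RHS]/(tens_add _ _) tens_addE. Qed.

Lemma tensE (x : tensor) : x = \sum_(p <- repr x) tens p.1 p.2.
Proof.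
rewrite -[LHS]tens_classK; elim: (repr x) => [|p s IH]; first by rewrite big_nil.
by rewrite big_cons tens_class_cons IH.
Qed.

Lemma tens_is_bilinear : bilinear_for *:%R *:%R tens.
Proof.
split=> [w a v v'|v a w w'].
  apply: etrans (_ : tens_class [:: (a *: v, w); (v', w)] = _).
    by apply/tens_classP; exact: TensDl.
  rewrite tens_class_cons /=; congr (_ + _).
  by rewrite -[RHS]/(tens_scale _ _) tens_scaleE.
apply: etrans (_ : tens_class [:: (v, a *: w); (v, w')] = _).
  by apply/tens_classP; exact: TensDr.
rewrite tens_class_cons /=; congr (_ + _).
rewrite -[RHS]/(tens_scale _ _) tens_scaleE /=.
by apply/tens_classP/TensSym; exact: TensZ.
Qed.

HB.instance Definition _ :=
  bilinear_isBilinear.Build K V W tensor *:%R *:%R tens tens_is_bilinear.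

(* The additive map sending v (x) w to f v w. It does not depend on the chosen
   representative as soon as f is biadditive and balanced. *)
Definition tens_lift (U : nmodType) (f : V -> W -> U) (x : tensor) : U :=
  \sum_(p <- repr x) f p.1 p.2.

Section Lift.
Variables (U : zmodType) (f : V -> W -> U).
Hypothesis fDl : forall v v' w, f (v + v') w = f v w + f v' w.
Hypothesis fDr : forall v w w', f v (w + w') = f v w + f v w'.
Hypothesis fZ : forall a v w, f (a *: v) w = f v (a *: w).

Lemma tens_lift_cong s t : tens_cong s t ->
  \sum_(p <- s) f p.1 p.2 = \sum_(p <- t) f p.1 p.2.
Proof.
elim=> {s t} [s|s t _ st|s t u _ st _ tu|s t s' t' _ ss _ tt|s t|w|v v' w
             |v w w'|b v w] //=; rewrite ?big_cat ?big_cons ?big_nil ?addr0 //=.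
- by rewrite st.
- by rewrite ss tt.
- by rewrite addrC.
- by apply: (addrI (f 0 w)); rewrite -fDl !addr0.
Qed.

Lemma tens_lift_class s : tens_lift f (tens_class s) = \sum_(p <- s) f p.1 p.2.
Proof. by apply: tens_lift_cong; exact: repr_tens_class. Qed.

Lemma tens_liftE v w : tens_lift f (tens v w) = f v w.
Proof. by rewrite tens_lift_class big_seq1. Qed.

Lemma tens_liftD : {morph tens_lift f : x y / x + y}.
Proof.
move=> x y; rewrite -[x]tens_classK -[y]tens_classK.
by rewrite -[tens_class _ + _]/(tens_add _ _) tens_addE !tens_lift_class big_cat.
Qed.

End Lift.

Lemma tens_lift_linear (U : lmodType K) (f : {bilinear V -> W -> U}) :
  linear (tens_lift f).
Proof.
have fDl v v' w : f (v + v') w = f v w + f v' w by rewrite linearDl.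
have fDr v w w' : f v (w + w') = f v w + f v w' by rewrite linearDr.
have fZ a v w : f (a *: v) w = f v (a *: w) by rewrite linearZl_LR linearZr_LR.
move=> a x y; rewrite tens_liftD //; congr (_ + _).
rewrite -[x]tens_classK -[_ *: tens_class _]/(tens_scale _ _) tens_scaleE.
rewrite !tens_lift_class // /tens_scale_seq big_map scaler_sumr.
by apply: eq_bigr => p _; rewrite linearZl_LR.
Qed.

End TensorProduct.

Section MatricesOverModule.
Variables (K : comNzRingType).

(* The product A v B for scalar matrices A, B and a matrix v over V. *)
Definition mxsandwich (V : lmodType K) m n p q
    (A : 'M[K]_(m, n)) (v : 'M[V]_(n, p)) (B : 'M[K]_(p, q)) : 'M[V]_(m, q) :=
  \matrix_(i, j) (\sum_k \sum_l (A i k * B l j) *: v k l).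

(* MathComp provides no scaling on matrices over a module. *)
Definition mxscale (V : lmodType K) m n (a : K) (v : 'M[V]_(m, n)) :
    'M[V]_(m, n) :=
  map_mx ( *:%R a) v.

(* The Kronecker product of two matrices over V and W. *)
Definition tensmx_tens (V W : lmodType K) m n p q
    (v : 'M[V]_(m, n)) (w : 'M[W]_(p, q)) : 'M[tensor V W]_(m * p, n * q) :=
  \matrix_(i, j) tens (v (mxtens_unindex i).1 (mxtens_unindex j).1)
                      (w (mxtens_unindex i).2 (mxtens_unindex j).2).

(* diag(e, ..., e) *)
Definition diag_cst (V : lmodType K) n (e : V) : 'M[V]_n :=
  \matrix_(i, j) (e *+ (i == j)).

(* The identification of M_n(M_k) with M_(nk). *)
Definition flatten_mx n k (v : 'M['M[K]_k]_n) : 'M[K]_(n * k) :=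
  \matrix_(i, j) v (mxtens_unindex i).1 (mxtens_unindex j).1
                   (mxtens_unindex i).2 (mxtens_unindex j).2.

(* The bilinear map M_k(V) x M_k(W) -> M_t(U) obtained by tensorizing lam with
   b, i.e. (alpha (x) v, beta (x) w) |-> lam alpha beta (x) b v w; the elements
   of M_k(V) = M_k (x) V are written in the basis of the matrix units of M_k. *)
Definition amplify k t (lam : 'M[K]_k -> 'M[K]_k -> 'M[K]_t)
    (V W U : lmodType K) (b : V -> W -> U) (v : 'M[V]_k) (w : 'M[W]_k) :
    'M[U]_t :=
  \matrix_(x, y) (\sum_i \sum_j \sum_i' \sum_j'
    lam (delta_mx i j) (delta_mx i' j') x y *: b (v i j) (w i' j')).

Lemma amplifyE k t (lam : {bilinear 'M[K]_k -> 'M[K]_k -> 'M[K]_t})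
    (V W U : lmodType K) (b : {bilinear V -> W -> U})
    (alpha beta : 'M[K]_k) (v : V) (w : W) :
  amplify lam b (\matrix_(i, j) (alpha i j *: v))
                (\matrix_(i, j) (beta i j *: w))
  = \matrix_(x, y) (lam alpha beta x y *: b v w).
Proof.
apply/matrixP => x y; rewrite !mxE.
rewrite [in RHS](matrix_sum_delta alpha) linear_sumlz summxE scaler_suml.
apply: eq_bigr => i _; rewrite linear_sumlz summxE scaler_suml.
apply: eq_bigr => j _; rewrite linearZl_LR [X in _ = X *: _]mxE.
rewrite [in RHS](matrix_sum_delta beta) linear_sumr summxE mulr_sumr scaler_suml.
apply: eq_bigr => i' _; rewrite linear_sumr summxE mulr_sumr scaler_suml.
apply: eq_bigr => j' _; rewrite linearZr_LR !mxE linearZl_LR linearZr_LR.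
by rewrite !scalerA /= mulrC mulrA.
Qed.

End MatricesOverModule.

Section ComplexMatrices.
Variable R : realType.
Local Notation C := R[i].

Definition adjmx m n (A : 'M[C]_(m, n)) : 'M[C]_(n, m) := (A ^t*)%sesqui.

Definition posmx n (A : 'M[C]_n) : Prop :=
  adjmx A = A /\ forall x : 'cV[C]_n, 0 <= (adjmx x *m A *m x) 0 0.

Definition vnorm n (x : 'cV[C]_n) : R :=
  Num.sqrt (\sum_i ComplexField.Normc.normc (x i 0) ^+ 2).

Definition opnorm m n (A : 'M[C]_(m, n)) : R :=
  sup [set vnorm (A *m x) | x in [set x : 'cV[C]_n | vnorm x <= 1]].

Definition bilnorm k t (lam : 'M[C]_k -> 'M[C]_k -> 'M[C]_t) : R :=
  sup [set opnorm (lam a.1 a.2) |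
        a in [set a : 'M[C]_k * 'M[C]_k | opnorm a.1 <= 1 /\ opnorm a.2 <= 1]].

(* The matrix unit in position (i, j), where the positions i, j are counted
   from 1; it is 0 if i or j is outside {1, ..., k}. In particular, with the
   truncated subtraction of nat, matunit k (i - r) j = 0 whenever i <= r. *)
Definition matunit k (i j : nat) : 'M[C]_k :=
  \matrix_(a, b) ((a.+1 == i) && (b.+1 == j))%:R.

Record opsys_data := OpSysData {
  sys_space :> lmodType C;
  sys_star : sys_space -> sys_space;
  sys_cone : forall n, set 'M[sys_space]_n;
  sys_unit : sys_space
}.

Definition mxstar (X : opsys_data) n (v : 'M[X]_n) : 'M[X]_n :=
  \matrix_(i, j) sys_star (v j i).

Definition is_involution (X : opsys_data) : Prop :=
  (forall x : X, sys_star (sys_star x) = x) /\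
  (forall (a : C) (x y : X),
     sys_star (a *: x + y) = (a^*)%C *: sys_star x + sys_star y).

(* Matrix sizes are positive integers: here and below nothing is required of,
   or used about, the matrices of size 0. *)
Definition matrix_ordering (X : opsys_data) : Prop :=
  [/\ forall n (v : 'M[X]_n), (0 < n)%N -> sys_cone v -> mxstar v = v,
      forall n, (0 < n)%N ->
        [/\ sys_cone (0 : 'M[X]_n),
            forall v w : 'M[X]_n, sys_cone v -> sys_cone w -> sys_cone (v + w),
            forall (r : R) (v : 'M[X]_n),
              0 <= r -> sys_cone v -> sys_cone (mxscale (r%:C)%C v)
          & forall v : 'M[X]_n, sys_cone v -> sys_cone (- v) -> v = 0]
    & forall n k (A : 'M[C]_(n, k)) (v : 'M[X]_n), (0 < n)%N -> (0 < k)%N ->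
        sys_cone v -> sys_cone (mxsandwich (adjmx A) v A)].

Definition archimedean_matrix_order_unit (X : opsys_data) : Prop :=
  [/\ sys_star (sys_unit X) = sys_unit X,
      forall n (v : 'M[X]_n), (0 < n)%N -> mxstar v = v ->
        exists2 r : R, 0 < r &
          sys_cone (mxscale (r%:C)%C (diag_cst n (sys_unit X)) - v)
    & forall n (v : 'M[X]_n), (0 < n)%N -> mxstar v = v ->
        (forall s : R, 0 < s ->
           sys_cone (mxscale (s%:C)%C (diag_cst n (sys_unit X)) + v)) ->
        sys_cone v].

Definition is_operator_system (X : opsys_data) : Prop :=
  [/\ is_involution X, matrix_ordering X & archimedean_matrix_order_unit X].

Record operator_system := OperatorSystem {
  opsys_of :> opsys_data;
  operator_systemP : is_operator_system opsys_of
}.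

(* M_k as an operator system, with M_n(M_k)^+ = M_(nk)^+. *)
Definition mx_system k : opsys_data :=
  @OpSysData 'M[C]_k (@adjmx k k) (fun n v => posmx (flatten_mx v)) 1%:M.

Definition is_ucp (X Y : opsys_data) (phi : X -> Y) : Prop :=
  [/\ linear phi, phi (sys_unit X) = sys_unit Y
    & forall n (v : 'M[X]_n), (0 < n)%N ->
        sys_cone v -> sys_cone (map_mx phi v : 'M[Y]_n)].

Definition tens_system (S T : opsys_data)
    (D : forall n, set 'M[tensor S T]_n) : opsys_data :=
  @OpSysData (tensor S T)
    (tens_lift (fun s t => tens (sys_star s) (sys_star t)))
    D
    (tens (sys_unit S) (sys_unit T)).

Definition operator_system_tensor_product
    (D : forall S T : operator_system, forall n, set 'M[tensor S T]_n) : Prop :=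
  forall S T : operator_system,
  [/\ is_operator_system (tens_system (D S T)),
      forall k l (P : 'M[S]_k) (Q : 'M[T]_l), (0 < k)%N -> (0 < l)%N ->
        sys_cone P -> sys_cone Q -> D S T (k * l)%N (tensmx_tens P Q)
    & forall k l (phi : S -> mx_system k) (psi : T -> mx_system l),
        (0 < k)%N -> (0 < l)%N -> is_ucp phi -> is_ucp psi ->
        @is_ucp (tens_system (D S T)) (mx_system (k * l))
          (tens_lift (fun s t => phi s *t psi t))].

Section Lambda.
Variables (tau : nat -> nat)
  (lam : forall k, {bilinear 'M[C]_k -> 'M[C]_k -> 'M[C]_(tau k)}).

Definition condN1 : Prop := tau 1 = 1%N.

Definition condN2 : Prop := forall k, (0 < k)%N -> bilnorm (lam k) = 1.

Definition condE1 : Prop := forall k, (0 < k)%N ->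
  exists p, (0 < p)%N /\
  exists (S : 'M[C]_(k, tau p)) (T : 'M[C]_(tau p, k)) (a : 'I_k -> 'M[C]_p),
  forall j1 j2 : 'I_k,
    S *m lam p (a j1) (a j2) *m T = if j1 == j2 then delta_mx j1 j1 else 0.

(* The positions of the two diagonal, resp. off-diagonal, blocks of a matrix
   partitioned according to r + s, with the indices counted from 1. *)
Definition diag_pos (r s : nat) (ij : nat * nat) : bool :=
  ((1 <= ij.1 <= r) && (1 <= ij.2 <= r))%N
  || ((r < ij.1 <= r + s) && (r < ij.2 <= r + s))%N.

Definition offdiag_pos (r s : nat) (ij : nat * nat) : bool :=
  ((1 <= ij.1 <= r) && (r < ij.2 <= r + s))%N
  || ((r < ij.1 <= r + s) && (1 <= ij.2 <= r))%N.

Definition diag_compression r s (P : 'M[C]_(tau r + tau s, tau (r + s))) :=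
  forall x y : nat * nat, diag_pos r s x -> diag_pos r s y ->
    P *m lam (r + s) (matunit _ x.1 x.2) (matunit _ y.1 y.2) *m adjmx P
    = block_mx
        (lam r (matunit r x.1 x.2) (matunit r y.1 y.2)) 0
        0 (lam s (matunit s (x.1 - r) (x.2 - r))
                 (matunit s (y.1 - r) (y.2 - r))).

Definition offdiag_compression r (P : 'M[C]_(tau r + tau r, tau (r + r))) :=
  forall x y : nat * nat, offdiag_pos r r x -> offdiag_pos r r y ->
    P *m lam (r + r) (matunit _ x.1 x.2) (matunit _ y.1 y.2) *m adjmx P
    = block_mx
        0 (lam r (matunit r x.1 (x.2 - r)) (matunit r y.1 (y.2 - r)))
        (lam r (matunit r (x.1 - r) x.2) (matunit r (y.1 - r) y.2)) 0.

Definition condE2 : Prop := forall r s, (0 < r)%N -> (0 < s)%N ->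
  exists P, opnorm P <= 1 /\ @diag_compression r s P.

Definition condE3 : Prop :=
  lam 1 1%:M 1%:M = 1%:M /\
  has_ubound [set bilnorm (lam k) | k in [set k | (0 < k)%N]].

Definition condW1 : Prop := forall p (g : 'M[C]_p), (0 < p)%N ->
  (exists (P : 'M[C]_(p, tau p)) (Q : 'M[C]_(tau p, p)),
     [/\ opnorm P <= 1, opnorm Q <= 1 & g = P *m lam p g 1%:M *m Q]) /\
  (exists (P : 'M[C]_(p, tau p)) (Q : 'M[C]_(tau p, p)),
     [/\ opnorm P <= 1, opnorm Q <= 1 & g = P *m lam p 1%:M g *m Q]).

Definition condW2 : Prop := forall p q (a1 a2 : 'M[C]_p) (b1 b2 : 'M[C]_q),
  (0 < p)%N -> (0 < q)%N ->
  exists (S : 'M[C]_(tau p * tau q, tau (p * q)))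
         (T : 'M[C]_(tau (p * q), tau p * tau q)),
    [/\ opnorm S <= 1, opnorm T <= 1
      & lam p a1 a2 *t lam q b1 b2
        = S *m lam (p * q) (a1 *t b1) (a2 *t b2) *m T].

Definition condO1 : Prop := forall r (i1 j1 i2 j2 : 'I_r), (0 < r)%N ->
  lam r (delta_mx i1 j1) (delta_mx i2 j2)
  = adjmx (lam r (delta_mx j1 i1) (delta_mx j2 i2)).

(* One and the same P serves for the diagonal and the off-diagonal blocks. *)
Definition condO2 : Prop := forall r, (0 < r)%N ->
  exists P, [/\ opnorm P <= 1, @diag_compression r r P
              & offdiag_compression P].

Definition condO3 : Prop := forall r p1 p2,
  (0 < r)%N -> (0 < p1)%N -> (0 < p2)%N ->
  forall (v : 'M['M[C]_p1]_r) (w : 'M['M[C]_p2]_r),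
    posmx (flatten_mx v) -> posmx (flatten_mx w) ->
    posmx (flatten_mx
      (amplify (lam r) (fun a b => a *t b : 'M[C]_(p1 * p2)) v w)).

Record standing_conditions : Prop := StandingConditions {
  tau_gt0 : forall k, (0 < k)%N -> (0 < tau k)%N;
  standingN1 : condN1;
  standingN2 : condN2;
  standingE1 : condE1;
  standingE2 : condE2;
  standingE3 : condE3;
  standingW1 : condW1;
  standingW2 : condW2
}.

Section Cones.
Variables S T : operator_system.

Definition pre_cone n : set 'M[tensor S T]_n :=
  [set P | exists j (s : 'M[S]_j) (t : 'M[T]_j) (alpha : 'M[C]_(n, tau j)),
    [/\ (0 < j)%N, sys_cone s, sys_cone t
      & P = mxsandwich alpha (amplify (lam j) (@tens C S T) s t)
              (adjmx alpha)]].

Definition lambda_cone n : set 'M[tensor S T]_n :=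
  [set P | forall r : R, 0 < r ->
    @pre_cone n
      (mxscale (r%:C)%C (diag_cst n (tens (sys_unit S) (sys_unit T))) + P)].

End Cones.
End Lambda.
End ComplexMatrices.

(* Main.v *)
(* Condition (E2) makes C_n closed under sums, so C_n is a cone stable under
   compressions that contains B (x) s (x) t for positive s, t and B = b b^*. Since
   positive elements span an operator system, every self-adjoint element is a real
   combination of such terms and is dominated by a multiple of the unit; this
   yields the order unit property and the compatibility of C_n^lambda with
   compressions, and the Archimedean closure does the rest.

   For (T2), average the compression P of (O2) with its conjugate by diag(1, -1) in
   both arguments: the uncontrolled mixed terms cancel and lambda_{2r} compresses to
   (Schur product on M_2) (x) lambda_r. Iterating down to lambda_1 shows that
   C_{2^m} contains the Schur products [s_pq (x) t_pq] of positive elements, and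
   P (x) Q is such a Schur product of compressions of P and Q.

   (T3) is (O3) followed by a limit. Finally the states of S separate its points (a
   maximal proper cone is total, hence gives a functional), so product states
   separate S (x) T, and (T3) applied to them shows that C_n^lambda is proper. *)
Require Import Defs.
From HB Require Import structures.
From mathcomp Require Import all_boot all_order all_algebra.
From mathcomp Require Import boolp classical_sets reals.
From mathcomp.real_closed Require Import complex mxtens.
From mathcomp Require Import ring lra zify.
Set Implicit Arguments.
Unset Strict Implicit.
Unset Printing Implicit Defensive.
Import Order.TTheory GRing.Theory Num.Theory.
Local Open Scope ring_scope.
Local Open Scope classical_set_scope.
Local Open Scope complex_scope.

(** * States of an operator system *)

Section TotalCone.
Variables (R : realType) (V : lmodType R[i]) (H K0 : set V) (e : V).

(** [H] is closed under sums and real multiples: it plays the role of the real space of self-adjoint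
    elements inside the complex space [V]. *)
Definition convex_cone (K : set V) : Prop :=
  [/\ K `<=` H, forall x y, K x -> K y -> K (x + y)
    & forall (r : R) x, 0 <= r -> K x -> K (r%:C *: x)].

Hypotheses (HD : forall x y, H x -> H y -> H (x + y))
  (HZ : forall (r : R) x, H x -> H (r%:C *: x)).
Hypotheses (coneK0 : convex_cone K0) (K0e : K0 e).

(** Zorn's lemma gives a largest cone [A] above [K0] that avoids [- e]. If [h] is not in [A], the
    cone generated by [A] and [h] contains [- e = k + r h] with [r > 0], so [- h] is a positive
    multiple of [k + e] and lies in [A]. *)
Lemma maximal_convex_cone : ~ K0 (- e) ->
  exists K, [/\ convex_cone K, K0 `<=` K, ~ K (- e)
              & forall h, H h -> K h \/ K (- h)].
Proof.
move=> K0Ne.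
pose P (A : set V) := A = set0 \/ [/\ convex_cone A, K0 `<=` A & ~ A (- e)].
have [F FP Ftot|A [PA Amax]] := @Zorn_bigcup V P.
  have FA A x : F A -> A x -> [/\ convex_cone A, K0 `<=` A & ~ A (- e)].
    by move=> FA Ax; have [A0|//] := FP _ FA; rewrite A0 in Ax.
  have [->|/set0P[x [A FFA Ax]]] := eqVneq (\bigcup_(X in F) X) set0.
    by left.
  right; split.
  - split.
    + by move=> y [B FB By]; have [[BH _ _] _ _] := FA _ _ FB By; exact: BH.
    + move=> y z [B FB By] [B' FB' Bz].
      have [[_ BD _] _ _] := FA _ _ FB By; have [[_ BD' _] _ _] := FA _ _ FB' Bz.
      have [BB'|B'B] := Ftot _ _ FB FB'.
        by exists B' => //; apply: BD' => //; exact: BB'.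
      by exists B => //; apply: BD => //; exact: B'B.
    + move=> r y r0 [B FB By]; exists B => //.
      by have [[_ _ BZ] _ _] := FA _ _ FB By; exact: BZ.
  - by move=> y K0y; exists A => //; have [_ + _] := FA _ _ FFA Ax; apply.
  - by case=> B FB By; have [_ _] := FA _ _ FB By; apply.
have {}PA : [/\ convex_cone A, K0 `<=` A & ~ A (- e)].
  case: PA => // A0; exfalso; apply: (Amax K0); last by right; split.
  by rewrite A0; split=> // /(_ _ K0e).
exists A; case: (PA) => -[AH AD AZ] K0A ANe; split=> // h Hh.
have [|Ah] := pselect (A h); first by left.
right; apply: contrapT => ANh.
pose B := [set x | exists k (r : R), [/\ A k, 0 <= r & x = k + r%:C *: h]].
have A0 : A 0.
  by have := @AZ 0 e (lexx _) (K0A _ K0e); rewrite scale0r.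
have AB : A `<=` B.
  by move=> x Ax; exists x, 0; split=> //; rewrite scale0r addr0.
apply: (Amax B).
  split=> // BA; apply: Ah; apply: BA; exists 0, 1; split=> //.
  by rewrite scale1r add0r.
right; split.
- split.
  + by move=> _ [k [r [Ak r0 ->]]]; apply: HD; [exact: AH|exact: HZ].
  + move=> _ _ [k [r [Ak r0 ->]]] [k' [r' [Ak' r0' ->]]].
    exists (k + k'), (r + r'); split; [exact: AD|exact: addr_ge0|].
    by rewrite addrACA rmorphD scalerDl.
  + move=> s _ s0 [k [r [Ak r0 ->]]].
    exists (s%:C *: k), (s * r); split; [exact: AZ|exact: mulr_ge0|].
    by rewrite scalerDr scalerA rmorphM.
- exact: subset_trans AB.
- case=> k [r [Ak r0 eE]].
  have [r00|rn0] := eqVneq r 0.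
    by apply: ANe; rewrite eE r00 scale0r addr0.
  apply: ANh.
  have -> : - h = (r^-1)%:C *: (k + e).
    have -> : k + e = - (r%:C *: h) by rewrite -[e]opprK eE opprD addNKr.
    by rewrite scalerN scalerA -rmorphM mulVf // scale1r.
  by apply: AZ; [rewrite invr_ge0|apply: AD => //; exact: K0A].
Qed.

End TotalCone.

(** * The functional of a total cone *)

Section ConeFunctional.
Variables (R : realType) (V : lmodType R[i]) (H K : set V) (e : V).
Hypotheses (HD : forall x y, H x -> H y -> H (x + y))
  (HZ : forall (r : R) x, H x -> H (r%:C *: x)).
Hypotheses (coneK : convex_cone H K) (Ke : K e) (KNe : ~ K (- e)).
Hypothesis total : forall h, H h -> K h \/ K (- h).
Hypothesis unit : forall h, H h -> exists2 r : R, 0 < r & K (r%:C *: e - h).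

Definition lower_levels (h : V) : set R := [set r | K (h - r%:C *: e)].
(** For a total cone with order unit [e], this is the only value at [h] that a positive functional
    with value 1 at [e] can take. *)
Definition cone_functional (h : V) : R := sup (lower_levels h).

Local Notation L := lower_levels.
Local Notation f := cone_functional.

Let KD x y : K x -> K y -> K (x + y).
Proof. by case: coneK => _ + _; apply. Qed.
Let KZ (r : R) x : 0 <= r -> K x -> K (r%:C *: x).
Proof. by case: coneK => _ _; apply. Qed.
Let He : H e. Proof. by case: coneK => + _ _; apply. Qed.
Let HN x : H x -> H (- x).
Proof.
by move=> Hx; rewrite -scaleN1r -[1](rmorph1 (real_complex R)) -rmorphN; exact: HZ.
Qed.

Let Kposmul (r : R) : K (r%:C *: e) -> 0 <= r.
Proof.
move=> Kr; rewrite leNgt; apply/negP => r0; apply: KNe.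
have -> : - e = ((- r)^-1)%:C *: (r%:C *: e).
  by rewrite scalerA -rmorphM invrN mulNr mulVf ?lt_eqF// rmorphN scaleN1r.
by apply: KZ => //; rewrite invr_ge0 oppr_ge0 ltW.
Qed.

(** The order unit dominates [- h], which gives a level, and [h], which bounds the levels from
    above. *)
Lemma has_sup_lower_levels h : H h -> has_sup (L h).
Proof.
move=> Hh; split.
  have [r _ Kr] := unit (HN Hh); exists (- r).
  by rewrite /lower_levels /= rmorphN scaleNr opprK addrC -[h in _ + h]opprK.
have [r _ Kr] := unit Hh; exists r => s Ls.
rewrite -subr_ge0; apply: Kposmul.
have -> : (r - s)%:C *: e = (r%:C *: e - h) + (h - s%:C *: e).
  by rewrite addrA subrK rmorphB scalerBl.
exact: KD.
Qed.

Lemma cone_functional_le h r : H h -> K (h - r%:C *: e) -> r <= f h.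
Proof. by move=> Hh Kr; apply: (sup_upper_bound (has_sup_lower_levels Hh)). Qed.

Lemma cone_functional_gt h r : H h -> f h < r -> K (r%:C *: e - h).
Proof.
move=> Hh fr; have : H (h - r%:C *: e) by apply: HD => //; apply/HN/HZ.
move=> /total[/(cone_functional_le Hh)|]; first by rewrite leNgt fr.
by rewrite opprB.
Qed.

Lemma cone_functional_superadd h h' : H h -> H h' -> f h + f h' <= f (h + h').
Proof.
move=> Hh Hh'; rewrite -lerBrDr; apply: ge_sup.
  by have [] := has_sup_lower_levels Hh.
move=> r Lr; rewrite lerBrDr addrC -lerBrDr.
apply: ge_sup; first by have [] := has_sup_lower_levels Hh'.
move=> r' Lr'; rewrite lerBrDr; apply: cone_functional_le; first exact: HD.
by rewrite [r' + r]addrC rmorphD scalerDl opprD addrACA; exact: (KD Lr Lr').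
Qed.

Lemma cone_functional0 : f 0 = 0.
Proof.
have H0 : H 0 by have := HZ 0 He; rewrite scale0r.
apply/eqP; rewrite eq_le; apply/andP; split; last first.
  by apply: cone_functional_le => //; rewrite scale0r subr0 -(scale0r e); exact: KZ.
rewrite leNgt; apply/negP => f0.
have [r] := sup_adherent f0 (has_sup_lower_levels H0).
rewrite /lower_levels /= sub0r subrr => Kr r0.
have : 0 <= - r by apply: Kposmul; rewrite rmorphN scaleNr.
by rewrite oppr_ge0 leNgt r0.
Qed.

(* Totality of K puts every r > f h above h, so the supremum of the lower levels
   is also the infimum of the upper ones. *)
Lemma cone_functionalN h : H h -> f (- h) = - f h.
Proof.
move=> Hh; apply/eqP; rewrite eq_le; apply/andP; split.
  have := cone_functional_superadd Hh (HN Hh).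
  by rewrite subrr cone_functional0; lra.
rewrite leNgt; apply/negP => lt.
pose r := (f h - f (- h)) / 2.
have : - r <= f (- h).
  apply: cone_functional_le; first exact: HN.
  rewrite rmorphN scaleNr opprK addrC; apply: cone_functional_gt => //.
  by rewrite /r; lra.
by rewrite /r; lra.
Qed.

Lemma cone_functionalD h h' : H h -> H h' -> f (h + h') = f h + f h'.
Proof.
move=> Hh Hh'; apply/eqP; rewrite eq_le cone_functional_superadd// andbT.
have := cone_functional_superadd (HD Hh Hh') (HN Hh').
by rewrite addrK cone_functionalN// lerBlDr.
Qed.

(** Scaling the levels by [s > 0] gives one inequality, and the same inequality for [s^-1] gives the
    other; negative scalars reduce to these by [cone_functionalN]. *)
Lemma cone_functionalZ r h : H h -> f (r%:C *: h) = r * f h.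
Proof.
move=> Hh.
have le (s : R) g : 0 < s -> H g -> s * f g <= f (s%:C *: g).
  move=> s0 Hg; rewrite -ler_pdivlMl//; apply: ge_sup.
    by have [] := has_sup_lower_levels Hg.
  move=> t Lt; rewrite ler_pdivlMl//; apply: cone_functional_le; first exact: HZ.
  by rewrite rmorphM -scalerA -scalerBr; apply: KZ => //; exact: ltW.
have pos (s : R) : 0 < s -> f (s%:C *: h) = s * f h.
  move=> s0; apply/eqP; rewrite eq_le le// andbT.
  have := le s^-1 (s%:C *: h); rewrite invr_gt0 => /(_ s0 (HZ s Hh)).
  by rewrite scalerA -rmorphM mulVf ?gt_eqF// scale1r -ler_pdivlMl ?invr_gt0// invrK.
have [->|/eqP/eqP] := eqVneq r 0; first by rewrite scale0r mul0r cone_functional0.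
rewrite neq_lt => /orP[r0|]; last exact: pos.
rewrite -[r]opprK rmorphN scaleNr cone_functionalN; last exact: HZ.
by rewrite pos ?oppr_gt0// !mulNr.
Qed.

Lemma cone_functional_ge0 h : K h -> 0 <= f h.
Proof.
move=> Kh; apply: cone_functional_le; last by rewrite scale0r subr0.
by case: coneK => + _ _; apply.
Qed.

Lemma cone_functional_unit : f e = 1.
Proof.
apply/eqP; rewrite eq_le; apply/andP; split.
  apply: ge_sup; first by have [] := has_sup_lower_levels He.
  move=> r Lr; rewrite -subr_ge0; apply: Kposmul.
  by rewrite rmorphB scalerBl scale1r.
apply: cone_functional_le => //; rewrite scale1r subrr.
by have := KZ (lexx 0) Ke; rewrite scale0r.
Qed.

End ConeFunctional.

Lemma conjcR (R : realType) (r : R) : ((r%:C)^*)%C = r%:C :> R[i].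
Proof. by rewrite /= oppr0. Qed.

(** * States and the separation of points *)

Section States.
Variables (R : realType) (X : operator_system R).

Definition pos1 (x : X) : Prop := sys_cone (const_mx x : 'M[X]_1).

Lemma sys_starK (x : X) : sys_star (sys_star x) = x.
Proof. by have [[+ _] _ _] := operator_systemP X; apply. Qed.

Lemma sys_starP (a : R[i]) (x y : X) :
  sys_star (a *: x + y) = (a^*)%C *: sys_star x + sys_star y.
Proof. by have [[_ +] _ _] := operator_systemP X; apply. Qed.

Lemma sys_starD (x y : X) : sys_star (x + y) = sys_star x + sys_star y.
Proof. by rewrite -[x]scale1r sys_starP rmorph1 !scale1r. Qed.

Lemma sys_star0 : sys_star (0 : X) = 0.
Proof. by apply: (addrI (sys_star 0)); rewrite -sys_starD !addr0. Qed.

Lemma sys_starZ (a : R[i]) (x : X) : sys_star (a *: x) = (a^*)%C *: sys_star x.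
Proof. by rewrite -[a *: x]addr0 sys_starP sys_star0 addr0. Qed.

Lemma sys_starN (x : X) : sys_star (- x) = - sys_star x.
Proof. by rewrite -scaleN1r sys_starZ rmorphN rmorph1 scaleN1r. Qed.

Lemma mxstar_const (x : X) :
  mxstar (const_mx x : 'M_1) = const_mx (sys_star x).
Proof. by apply/matrixP => i j; rewrite !mxE. Qed.

Lemma mxscale_const (a : R[i]) (x : X) :
  mxscale a (const_mx x : 'M_1) = const_mx (a *: x).
Proof. by apply/matrixP => i j; rewrite !mxE. Qed.

Lemma diag_cst1 (x : X) : diag_cst 1 x = const_mx x.
Proof. by apply/matrixP => i j; rewrite !mxE !ord1 eqxx. Qed.

Lemma pos1_star (x : X) : pos1 x -> sys_star x = x.
Proof.
have [_ [+ _ _] _] := operator_systemP X => /(_ 1 (const_mx x) isT) + px => /(_ px).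
by rewrite mxstar_const => /matrixP/(_ 0 0); rewrite !mxE.
Qed.

Lemma pos1D (x y : X) : pos1 x -> pos1 y -> pos1 (x + y).
Proof.
have [_ [_ /(_ 1 isT)[_ + _ _] _] _] := operator_systemP X => cD px py.
by rewrite /pos1 raddfD; exact: cD.
Qed.

Lemma pos1Z (r : R) (x : X) : 0 <= r -> pos1 x -> pos1 (r%:C *: x).
Proof.
have [_ [_ /(_ 1 isT)[_ _ + _] _] _] := operator_systemP X => cZ r0 px.
by rewrite /pos1 -mxscale_const; exact: cZ.
Qed.

Lemma pos1_anti (x : X) : pos1 x -> pos1 (- x) -> x = 0.
Proof.
have [_ [_ /(_ 1 isT)[_ _ _ +] _] _] := operator_systemP X => cN px.
rewrite /pos1 raddfN => /(cN _ px).
by move/matrixP/(_ 0 0); rewrite !mxE.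
Qed.

Lemma sys_star_unit : sys_star (sys_unit X) = sys_unit X.
Proof. by have [_ _ []] := operator_systemP X. Qed.

Lemma pos1_order_unit (x : X) : sys_star x = x ->
  exists2 r : R, 0 < r & pos1 (r%:C *: sys_unit X - x).
Proof.
have [_ _ [_ + _]] := operator_systemP X => /(_ 1 (const_mx x) isT) + xE.
rewrite mxstar_const xE => /(_ erefl)[r r0 pr]; exists r => //.
by rewrite /pos1 raddfB /= -mxscale_const -diag_cst1.
Qed.

Lemma pos1_archimedean (x : X) : sys_star x = x ->
  (forall s : R, 0 < s -> pos1 (s%:C *: sys_unit X + x)) -> pos1 x.
Proof.
have [_ _ [_ _]] := operator_systemP X => /(_ 1 (const_mx x) isT) + xE px.
rewrite mxstar_const xE => /(_ erefl); apply=> s /px.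
by rewrite /pos1 raddfD /= -mxscale_const -diag_cst1.
Qed.

Lemma pos1_unit : pos1 (sys_unit X).
Proof.
have [r r0] := pos1_order_unit sys_star0; rewrite subr0 => pr.
have -> : sys_unit X = (r^-1)%:C *: (r%:C *: sys_unit X).
  by rewrite scalerA -rmorphM mulVf ?gt_eqF// scale1r.
by apply: pos1Z => //; rewrite invr_ge0 ltW.
Qed.

Lemma pos1_0 : pos1 (0 : X).
Proof. by have := pos1Z (lexx 0) pos1_unit; rewrite scale0r. Qed.

Lemma sys_star_re (x : X) : sys_star (x + sys_star x) = x + sys_star x.
Proof. by rewrite sys_starD sys_starK addrC. Qed.

Lemma sys_star_im (x : X) :
  sys_star ('i *: (x - sys_star x)) = 'i *: (x - sys_star x).
Proof.
rewrite sys_starZ sys_starD sys_starN sys_starK -opprB scalerN -scaleNr.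
by congr (_ *: _); apply/eqP; rewrite eq_complex /= oppr0 opprK !eqxx.
Qed.

Definition is_state (f : X -> R[i]) : Prop :=
  [/\ scalar f, f (sys_unit X) = 1 & forall x, pos1 x -> 0 <= f x].

Section StateTheory.
Variables (f : X -> R[i]) (sf : is_state f).

Lemma stateD x y : f (x + y) = f x + f y.
Proof. by case: sf => fl _ _; rewrite -[x]scale1r fl mul1r scale1r. Qed.

Lemma state0 : f 0 = 0.
Proof. by apply: (addrI (f 0)); rewrite -stateD !addr0. Qed.

Lemma stateZ a x : f (a *: x) = a * f x.
Proof. by case: sf => fl _ _; rewrite -[a *: x]addr0 fl state0 addr0. Qed.

(** Some [r 1 - x] is positive, so [r - f x] is nonnegative and in particular real. *)
Lemma state_real x : sys_star x = x -> complex.Im (f x) = 0.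
Proof.
move=> xE; have [r _ pr] := pos1_order_unit xE; case: (sf) => _ fu fp.
have : f (r%:C *: sys_unit X - x) = r%:C - f x.
  by rewrite stateD -scaleN1r !stateZ fu mulr1 mulN1r.
move: (fp _ pr) => + E; rewrite E => /ger0_Im /=; case: (f x) => a b /=.
by rewrite sub0r => /eqP; rewrite oppr_eq0 => /eqP.
Qed.

Lemma state_star x : f (sys_star x) = ((f x)^*)%C.
Proof.
have := state_real (sys_star_re x); have := state_real (sys_star_im x).
rewrite stateZ !stateD -scaleN1r stateZ mulN1r.
case: (f x) (f (sys_star x)) => a b [c d] /=.
rewrite mul0r mul1r add0r => /subr0_eq -> bd; congr (_ +i* _).
by apply/eqP; rewrite -addr_eq0 addrC bd.
Qed.

End StateTheory.

(** Up to sign [x] is not positive, so by the Archimedean axiom [w = s 1 + x] is not positive for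
    some [s > 0]. A total cone containing the positive elements and [- w] but not [- 1] yields a
    functional with [f w <= 0], hence [f x <= - s < 0]. *)
Lemma exists_state_sa (x : X) : sys_star x = x -> x != 0 ->
  exists2 f, is_state f & f x != 0.
Proof.
move=> xE x0.
wlog npx : x xE x0 / ~ pos1 x.
  move=> W; have [px|] := pselect (pos1 x); last exact: W.
  have [|||f sf fx] := W (- x).
  - by rewrite sys_starN xE.
  - by rewrite oppr_eq0.
  - by move=> /(pos1_anti px) /eqP; rewrite (negPf x0).
  exists f => //; move: fx; rewrite -scaleN1r stateZ// mulN1r oppr_eq0.
  by [].
have [s [s0 nps]] : exists s : R, 0 < s /\ ~ pos1 (s%:C *: sys_unit X + x).
  apply: contrapT => ns; apply: npx; apply: pos1_archimedean => // s s0.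
  by apply: contrapT => ps; apply: ns; exists s.
set u := sys_unit X in nps *; set w := _ + x in nps.
pose H := [set h : X | sys_star h = h].
have HD h h' : H h -> H h' -> H (h + h').
  by rewrite /H /= sys_starD => -> ->.
have HZ (r : R) h : H h -> H (r%:C *: h).
  by rewrite /H /= sys_starZ conjcR => ->.
have Hu : H u by exact: sys_star_unit.
have Hw : H w by apply: HD => //; exact: HZ.
have HN h : H h -> H (- h) by rewrite /H /= sys_starN => ->.
pose K0 := [set h | exists c (t : R), [/\ pos1 c, 0 <= t & h = c - t%:C *: w]].
have pK0 : pos1 `<=` K0.
  by move=> c pc; exists c, 0; split=> //; rewrite scale0r subr0.
have cK0 : convex_cone H K0.
  split.
  - move=> _ [c [t [pc _ ->]]]; apply: HD; first exact: pos1_star.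
    exact/HN/HZ.
  - move=> _ _ [c [t [pc t0 ->]]] [c' [t' [pc' t0' ->]]].
    exists (c + c'), (t + t'); split; [exact: pos1D|exact: addr_ge0|].
    by rewrite rmorphD scalerDl opprD addrACA.
  - move=> r _ r0 [c [t [pc t0 ->]]]; exists (r%:C *: c), (r * t).
    split; [exact: pos1Z|exact: mulr_ge0|].
    by rewrite rmorphM scalerBr scalerA.
(* From [- u = c - t w] with [t > 0], [w] would be a positive multiple of [c + u]. With [t = 0],
   both [u] and [- u] would be positive, so [u = 0], and domination by the order unit would again
   make [w] positive. *)
have K0Nu : ~ K0 (- u).
  move=> [c [t [pc t0 uE]]]; apply: nps.
  have [t00|tn0] := eqVneq t 0.
    have u0 : u = 0.
      apply: pos1_anti; first exact: pos1_unit.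
      by rewrite uE t00 scale0r subr0.
    have [r _] := pos1_order_unit (HN _ Hw).
    by rewrite -/u u0 scaler0 sub0r opprK.
  have -> : w = (t^-1)%:C *: (c + u).
    have -> : c + u = t%:C *: w by rewrite -[u]opprK uE opprB addrC subrK.
    by rewrite scalerA -rmorphM mulVf // scale1r.
  by apply: pos1Z; [rewrite invr_ge0|apply: pos1D => //; exact: pos1_unit].
have [K [cK K0K KNu Ktot]] := maximal_convex_cone HD HZ cK0 (pK0 _ pos1_unit) K0Nu.
have Ku : K u by apply/K0K/pK0/pos1_unit.
have unitK h : H h -> exists2 r : R, 0 < r & K (r%:C *: u - h).
  by move=> /pos1_order_unit[r r0 pr]; exists r => //; exact/K0K/pK0.
pose f := cone_functional K u.
have fD h h' : H h -> H h' -> f (h + h') = f h + f h' :=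
  @cone_functionalD _ _ _ _ _ HD HZ cK Ku KNu Ktot unitK h h'.
have fZ r h : H h -> f (r%:C *: h) = r * f h :=
  @cone_functionalZ _ _ _ _ _ HD HZ cK Ku KNu Ktot unitK r h.
have fN h : H h -> f (- h) = - f h :=
  @cone_functionalN _ _ _ _ _ HD HZ cK Ku KNu Ktot unitK h.
have fu : f u = 1 :=
  cone_functional_unit HZ cK Ku KNu unitK.
have f_ge0 h : K h -> 0 <= f h :=
  @cone_functional_ge0 _ _ _ _ _ HZ cK KNu unitK h.
pose re (h : X) := (2^-1 : R)%:C *: (h + sys_star h).
have Hre h : H (re h) by apply: HZ; exact: sys_star_re.
have reD h h' : re (h + h') = re h + re h'.
  by rewrite /re sys_starD addrACA scalerDr.
have reZ (r : R) h : re (r%:C *: h) = r%:C *: re h.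
  by rewrite /re sys_starZ conjcR -scalerDr !scalerA mulrC.
have reH h : H h -> re h = h.
  move=> Hh; rewrite /re Hh -[h]scale1r -scalerDl scalerA.
  congr (_ *: _); apply/eqP; rewrite eq_complex /=.
  by apply/andP; split; apply/eqP; [field|ring].
pose g h := f (re h).
have gD h h' : g (h + h') = g h + g h' by rewrite /g reD fD.
have gZ (r : R) h : g (r%:C *: h) = r * g h by rewrite /g reZ fZ.
have giH h : H h -> g ('i *: h) = 0.
  move=> Hh; rewrite /g /re sys_starZ Hh -scalerDl.
  have -> : ('i : R[i]) + ('i^*)%C = 0.
    by apply/eqP; rewrite eq_complex /=; apply/andP; split; apply/eqP; ring.
  by rewrite scale0r scaler0 -(subrr u) fD ?fN ?subrr//; exact: HN.
(* The usual extension of the real-linear functional [g] to a complex-linear one with real part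
   [g]. *)
pose F h := (g h) -i* (g ('i *: h)).
have FE h : H h -> F h = (f h)%:C by move=> Hh; rewrite /F giH// /g reH// oppr0.
exists F.
  split.
  - move=> [a b] h h'.
    have aE : (a +i* b) *: h = a%:C *: h + b%:C *: ('i *: h).
      rewrite scalerA -scalerDl; congr (_ *: _).
      by apply/eqP; rewrite eq_complex /=; apply/andP; split; apply/eqP; ring.
    have ib : 'i *: ((a +i* b) *: h) = a%:C *: ('i *: h) + (- b)%:C *: h.
      rewrite !scalerA -scalerDl; congr (_ *: _).
      by apply/eqP; rewrite eq_complex /=; apply/andP; split; apply/eqP; ring.
    rewrite /F scalerDr ib aE !gD !gZ; apply/eqP; rewrite eq_complex /=.
    by apply/andP; split; apply/eqP; ring.
  - by rewrite FE// fu.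
  - by move=> h ph; rewrite FE; [rewrite ler0c; exact/f_ge0/K0K/pK0|exact: pos1_star].
rewrite FE// eq_complex /= eqxx andbT.
have : 0 <= f (- w).
  by apply/f_ge0/K0K; exists 0, 1; split=> //; [exact: pos1_0|rewrite scale1r sub0r].
rewrite fN// fD//; last exact: HZ.
by rewrite fZ// fu; move=> fw; apply: ltr0_neq0; lra.
Qed.

(** The real and imaginary parts of [x] are not both 0. A state vanishing at [x] also vanishes at
    [sys_star x] by [state_star], hence at both parts. *)
Lemma exists_state (x : X) : x != 0 -> exists2 f, is_state f & f x != 0.
Proof.
move=> x0.
have [re0|re0] := eqVneq (x + sys_star x) 0.
  have xE : sys_star x = - x by apply/eqP; rewrite -addr_eq0 addrC re0.
  have [||f sf fx] := @exists_state_sa ('i *: (x - sys_star x)).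
  - exact: sys_star_im.
  - rewrite xE opprK -mulr2n scaler_eq0 eq_complex /= oner_eq0 andbF /=.
    by rewrite -scaler_nat scaler_eq0 pnatr_eq0.
  exists f => //; apply: contraNneq fx.
  by rewrite stateZ// xE opprK stateD// => ->; rewrite addr0 mulr0.
have [f sf fx] := exists_state_sa (sys_star_re x) re0.
exists f => //; apply: contraNneq fx.
by rewrite stateD// state_star// => ->; rewrite rmorph0 addr0.
Qed.

End States.

(** * Matrices over modules *)

Section MatricesOverModules.
Variable K : comNzRingType.
Implicit Types V W U : lmodType K.

(** The elementary tensor of [A] and [x], under the identification of matrices over [V] with scalar
    matrices tensored with [V]. *)
Definition matens V m n (A : 'M[K]_(m, n)) (x : V) : 'M[V]_(m, n) :=
  \matrix_(i, j) (A i j *: x).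

Lemma matensDl V m n (A B : 'M[K]_(m, n)) (x : V) :
  matens (A + B) x = matens A x + matens B x.
Proof. by apply/matrixP => i j; rewrite !mxE scalerDl. Qed.

Lemma matensDr V m n (A : 'M[K]_(m, n)) (x y : V) :
  matens A (x + y) = matens A x + matens A y.
Proof. by apply/matrixP => i j; rewrite !mxE scalerDr. Qed.

Lemma matens0 V m n (x : V) : matens (0 : 'M_(m, n)) x = 0.
Proof. by apply/matrixP => i j; rewrite !mxE scale0r. Qed.

Lemma matens0r V m n (A : 'M[K]_(m, n)) : matens A (0 : V) = 0.
Proof. by apply/matrixP => i j; rewrite !mxE scaler0. Qed.

Lemma matensZ V m n (A : 'M[K]_(m, n)) a (x : V) :
  matens A (a *: x) = matens (a *: A) x.
Proof. by apply/matrixP => i j; rewrite !mxE scalerA mulrC. Qed.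

Lemma matens_polarization V m n (M M' N1 N2 N3 N4 : 'M[K]_(m, n)) (x : V) :
  M + M' = (N1 + N2 + (N3 + N4)) + (N1 + N2 + (N3 + N4)) ->
  matens M x + matens M' x =
  (matens N1 x + matens N2 x + (matens N3 x + matens N4 x)) *+ 2.
Proof. by move=> E; rewrite -matensDl E !matensDl mulr2n. Qed.

Lemma mx_matens V m n (v : 'M[V]_(m, n)) :
  v = \sum_i \sum_j matens (delta_mx i j) (v i j).
Proof.
apply/matrixP => i j; rewrite summxE (bigD1 i)//= summxE (bigD1 j)//=.
rewrite !mxE !eqxx scale1r big1 => [|j' /negPf j'j].
  rewrite addr0 big1 ?addr0// => i' /negPf i'i; rewrite summxE big1// => j' _.
  by rewrite !mxE eq_sym i'i scale0r.
by rewrite !mxE [j == _]eq_sym j'j andbF scale0r.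
Qed.

(** Every matrix over [V] is a sum of elementary tensors. This reduces identities about matrices
    over modules to identities about scalar matrices. *)
Lemma additive_ext V m n (U : zmodType) (F G : 'M[V]_(m, n) -> U) :
  {morph F : x y / x + y} -> {morph G : x y / x + y} ->
  (forall A x, F (matens A x) = G (matens A x)) -> F =1 G.
Proof.
move=> FD GD FG v.
have F0 : F 0 = 0 by apply: (addrI (F 0)); rewrite -FD !addr0.
have G0 : G 0 = 0 by apply: (addrI (G 0)); rewrite -GD !addr0.
rewrite [v]mx_matens !(big_morph F FD F0) !(big_morph G GD G0).
apply: eq_bigr => i _; rewrite !(big_morph F FD F0) !(big_morph G GD G0).
by apply: eq_bigr => j _; exact: FG.
Qed.

Lemma mxsandwichD V m n p q (A : 'M[K]_(m, n)) (v w : 'M[V]_(n, p))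
    (B : 'M[K]_(p, q)) :
  mxsandwich A (v + w) B = mxsandwich A v B + mxsandwich A w B.
Proof.
apply/matrixP => i j; rewrite !mxE -big_split; apply: eq_bigr => k _.
by rewrite -big_split; apply: eq_bigr => l _; rewrite !mxE scalerDr.
Qed.

Lemma mxsandwich_matens V m n p q (A : 'M[K]_(m, n)) (B : 'M[K]_(n, p))
    (C : 'M[K]_(p, q)) (x : V) :
  mxsandwich A (matens B x) C = matens (A *m B *m C) x.
Proof.
apply/matrixP => i j; rewrite !mxE scaler_suml exchange_big.
apply: eq_bigr => l _; rewrite mxE mulr_suml scaler_suml.
apply: eq_bigr => k _; rewrite !mxE scalerA; congr (_ *: _).
by rewrite mulrAC.
Qed.

Lemma mxsandwichA V m' m n p q q' (A' : 'M[K]_(m', m)) (A : 'M[K]_(m, n))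
    (v : 'M[V]_(n, p)) (B : 'M[K]_(p, q)) (B' : 'M[K]_(q, q')) :
  mxsandwich A' (mxsandwich A v B) B' = mxsandwich (A' *m A) v (B *m B').
Proof.
move: v; apply: additive_ext => [v w|v w|C x]; rewrite ?mxsandwichD//.
by rewrite !mxsandwich_matens !mulmxA.
Qed.

Lemma mxscaleE V m n a (v : 'M[V]_(m, n)) :
  mxscale a v = mxsandwich a%:M v 1%:M.
Proof.
move: v; apply: additive_ext => [v w|v w|C x]; rewrite ?mxsandwichD//.
  by apply/matrixP => i j; rewrite !mxE scalerDr.
rewrite mxsandwich_matens mulmx1 mul_scalar_mx.
by apply/matrixP => i j; rewrite !mxE scalerA.
Qed.

Lemma mxscale1 V m n (v : 'M[V]_(m, n)) : mxscale 1 v = v.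
Proof. by apply/matrixP => i j; rewrite !mxE scale1r. Qed.

Lemma mxsandwich0l V m n p q (v : 'M[V]_(n, p)) (B : 'M[K]_(p, q)) :
  mxsandwich (0 : 'M_(m, n)) v B = 0.
Proof.
apply/matrixP => i j; rewrite !mxE big1// => k _; rewrite big1// => l _.
by rewrite mxE mul0r scale0r.
Qed.

Lemma mxsandwich0r V m n p q (A : 'M[K]_(m, n)) (v : 'M[V]_(n, p)) :
  mxsandwich A v (0 : 'M_(p, q)) = 0.
Proof.
apply/matrixP => i j; rewrite !mxE big1// => k _; rewrite big1// => l _.
by rewrite mxE mulr0 scale0r.
Qed.

Lemma mxsandwichE V m n p q (A : 'M[K]_(m, n)) (v : 'M[V]_(n, p))
    (B : 'M[K]_(p, q)) i j :
  mxsandwich A v B i j = \sum_k \sum_l (A i k * B l j) *: v k l.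
Proof. by rewrite mxE. Qed.

Lemma map_mxsandwich V W (f : V -> W) m n p q (A : 'M[K]_(m, n))
    (v : 'M[V]_(n, p)) (B : 'M[K]_(p, q)) : linear f ->
  map_mx f (mxsandwich A v B) = mxsandwich A (map_mx f v) B.
Proof.
move=> fl; pose g : {linear V -> W} := HB.pack f (GRing.isLinear.Build _ _ _ _ f fl).
have fg : f =1 g by [].
apply/matrixP => i j; rewrite !mxE fg linear_sum; apply: eq_bigr => k _.
by rewrite linear_sum; apply: eq_bigr => l _; rewrite linearZ mxE fg.
Qed.

Section Amplify.
Variables (k t : nat) (lam : {bilinear 'M[K]_k -> 'M[K]_k -> 'M[K]_t}).
Variables (V W U : lmodType K) (b : {bilinear V -> W -> U}).

Lemma amplifyDl v v' w :
  amplify lam b (v + v') w = amplify lam b v w + amplify lam b v' w.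
Proof.
apply/matrixP => x y; rewrite !mxE.
do 4 ![rewrite -big_split; apply: eq_bigr => ? _].
by rewrite mxE linearDl scalerDr.
Qed.

Lemma amplifyDr v w w' :
  amplify lam b v (w + w') = amplify lam b v w + amplify lam b v w'.
Proof.
apply/matrixP => x y; rewrite !mxE.
do 4 ![rewrite -big_split; apply: eq_bigr => ? _].
by rewrite mxE linearDr scalerDr.
Qed.

Lemma amplify_matens (alpha beta : 'M[K]_k) v w :
  amplify lam b (matens alpha v) (matens beta w) = matens (lam alpha beta) (b v w).
Proof. exact: amplifyE. Qed.

End Amplify.

End MatricesOverModules.

(** * Adjoints and compressions of positive elements *)

Section Adjoint.
Variable R : realType.
Local Notation C := R[i].

Lemma mxscale_half (V : lmodType C) m n (v : 'M[V]_(m, n)) :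
  mxscale (2^-1)%:C (v *+ 2) = v.
Proof.
apply/matrixP => i j; rewrite [v *+ 2]mulr2n !mxE -mulr2n -scaler_nat scalerA.
rewrite -(rmorph_nat (real_complex R)) -rmorphM mulVf ?pnatr_eq0//.
by rewrite scale1r.
Qed.

Lemma adjmxE m n (A : 'M[C]_(m, n)) i j : adjmx A i j = ((A j i)^*)%C.
Proof. by rewrite !mxE. Qed.

Lemma adjmxK m n (A : 'M[C]_(m, n)) : adjmx (adjmx A) = A.
Proof. by apply/matrixP => i j; rewrite !adjmxE conjcK. Qed.

Lemma adjmxM m n p (A : 'M[C]_(m, n)) (B : 'M[C]_(n, p)) :
  adjmx (A *m B) = adjmx B *m adjmx A.
Proof.
apply/matrixP => i j; rewrite adjmxE !mxE rmorph_sum; apply: eq_bigr => k _.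
by rewrite !adjmxE rmorphM mulrC.
Qed.

Lemma adjmxD m n (A B : 'M[C]_(m, n)) : adjmx (A + B) = adjmx A + adjmx B.
Proof. by apply/matrixP => i j; rewrite !(adjmxE, mxE) rmorphD. Qed.

Lemma adjmxN m n (A : 'M[C]_(m, n)) : adjmx (- A) = - adjmx A.
Proof. by apply/matrixP => i j; rewrite !(adjmxE, mxE) rmorphN. Qed.

Lemma adjmx0 m n : adjmx (0 : 'M[C]_(m, n)) = 0.
Proof. by apply/matrixP => i j; rewrite !(adjmxE, mxE) rmorph0. Qed.

Lemma adjmx_scalar n a : adjmx (a%:M : 'M[C]_n) = (a^*%C)%:M.
Proof. by apply/matrixP => i j; rewrite adjmxE !mxE eq_sym rmorphMn. Qed.

Lemma adjmx_delta m n (i : 'I_m) (j : 'I_n) :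
  adjmx (delta_mx i j : 'M[C]_(m, n)) = delta_mx j i.
Proof. by apply/matrixP => k l; rewrite adjmxE !mxE conjc_nat andbC. Qed.

Lemma adjmx_row_mx m n p (A : 'M[C]_(m, n)) (B : 'M[C]_(m, p)) :
  adjmx (row_mx A B) = col_mx (adjmx A) (adjmx B).
Proof. by rewrite /adjmx tr_row_mx map_col_mx. Qed.

Lemma adjmx_col_mx m n p (A : 'M[C]_(m, n)) (B : 'M[C]_(p, n)) :
  adjmx (col_mx A B) = row_mx (adjmx A) (adjmx B).
Proof. by rewrite /adjmx tr_col_mx map_row_mx. Qed.

Lemma mxstarD (X : operator_system R) n : {morph @mxstar R X n : v w / v + w}.
Proof. by move=> v w; apply/matrixP => i j; rewrite !mxE sys_starD. Qed.

Lemma cone_sandwich (X : operator_system R) n m (A : 'M[C]_(m, n)) (v : 'M[X]_n) :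
  (0 < n)%N -> (0 < m)%N -> sys_cone v -> sys_cone (mxsandwich A v (adjmx A)).
Proof.
have [_ [_ _ cS] _] := operator_systemP X => n0 m0 cv.
by rewrite -{1}[A]adjmxK; exact: cS.
Qed.

Lemma coneD (X : operator_system R) n (v w : 'M[X]_n) :
  (0 < n)%N -> sys_cone v -> sys_cone w -> sys_cone (v + w).
Proof.
by have [_ [_ + _] _] := operator_systemP X => /(_ n) + n0 => /(_ n0)[_ + _ _]; apply.
Qed.

End Adjoint.

(** * Diagonal and off-diagonal compressions *)

Section Blocks.
Variable K : comNzRingType.

Lemma linear_delta (U : lmodType K) m n (f : 'M[K]_(m, n) -> U) :
  linear f -> forall X, f X = \sum_i \sum_j X i j *: f (delta_mx i j).
Proof.
move=> fl X.
pose g : {linear 'M[K]_(m, n) -> U} := HB.pack f (GRing.isLinear.Build _ _ _ _ f fl).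
have fg : f =1 g by [].
rewrite fg {1}[X]matrix_sum_delta linear_sum; apply: eq_bigr => i _.
by rewrite linear_sum; apply: eq_bigr => j _; rewrite linearZ.
Qed.

(** Conditions (E2), (O1) and (O2) constrain [lam] on matrix units; this carries such identities
    over to all matrices. *)
Lemma bilinear_delta_ext (U : lmodType K) m n (F G : 'M[K]_(m, n) -> 'M[K]_(m, n) -> U) :
  (forall Y, linear (F^~ Y)) -> (forall X, linear (F X)) ->
  (forall Y, linear (G^~ Y)) -> (forall X, linear (G X)) ->
  (forall i j i' j',
     F (delta_mx i j) (delta_mx i' j') = G (delta_mx i j) (delta_mx i' j')) ->
  forall X Y, F X Y = G X Y.
Proof.
move=> Fl Fr Gl Gr FG X Y.
rewrite (linear_delta (Fl Y)) (linear_delta (Gl Y)).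
apply: eq_bigr => i _; apply: eq_bigr => j _; congr (_ *: _).
rewrite (linear_delta (Fr _)) (linear_delta (Gr _)).
by apply: eq_bigr => i' _; apply: eq_bigr => j' _; rewrite FG.
Qed.

Variables r s : nat.

(** Restriction to the positions allowed by [diag_pos], as a linear projection, so that the
    compression identity can be stated for arbitrary matrices. *)
Definition diag_part (X : 'M[K]_(r + s)) : 'M[K]_(r + s) :=
  block_mx (ulsubmx X) 0 0 (drsubmx X).

Definition offdiag_part (X : 'M[K]_(r + s)) : 'M[K]_(r + s) :=
  block_mx 0 (ursubmx X) (dlsubmx X) 0.

Lemma diag_part_linear : linear diag_part.
Proof.
move=> a X Y; apply/matrixP => i j; rewrite !mxE.
by case: split => k; rewrite !mxE; case: split => l; rewrite !mxE ?mulr0 ?addr0.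
Qed.

Lemma offdiag_part_linear : linear offdiag_part.
Proof.
move=> a X Y; apply/matrixP => i j; rewrite !mxE.
by case: split => k; rewrite !mxE; case: split => l; rewrite !mxE ?mulr0 ?addr0.
Qed.

HB.instance Definition _ := GRing.isLinear.Build _ _ _ _ diag_part diag_part_linear.
HB.instance Definition _ :=
  GRing.isLinear.Build _ _ _ _ offdiag_part offdiag_part_linear.

Lemma diag_part_block A B C D : diag_part (block_mx A B C D) = block_mx A 0 0 D.
Proof. by rewrite /diag_part block_mxKul block_mxKdr. Qed.

Lemma offdiag_part_block A B C D : offdiag_part (block_mx A B C D) = block_mx 0 B C 0.
Proof. by rewrite /offdiag_part block_mxKur block_mxKdl. Qed.

End Blocks.

Section Compressions.
Variables (R : realType) (tau : nat -> nat)
  (lam : forall k, {bilinear 'M[R[i]]_k -> 'M[R[i]]_k -> 'M[R[i]]_(tau k)}).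
Local Notation C := R[i].

Lemma matunit_delta k (i j : 'I_k) : matunit R k i.+1 j.+1 = delta_mx i j.
Proof. by apply/matrixP => a b; rewrite !mxE !eqSS. Qed.

Lemma matunit_ul r s i j :
  ulsubmx (matunit R (r + s) i j) = matunit R r i j.
Proof. by apply/matrixP => a b; rewrite !mxE. Qed.

(** For [i <= r] the truncated difference [i - r] is 0, which is not a position counted from 1, so
    both sides vanish. *)
Lemma matunit_dr r s i j :
  drsubmx (matunit R (r + s) i j) = matunit R s (i - r) (j - r).
Proof.
apply/matrixP => a b; rewrite !mxE /=; congr ((_ && _)%:R); lia.
Qed.

Lemma matunit_ur r i j :
  ursubmx (matunit R (r + r) i j) = matunit R r i (j - r).
Proof.
apply/matrixP => a b; rewrite !mxE /=; congr ((_ && _)%:R); lia.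
Qed.

Lemma matunit_dl r i j :
  dlsubmx (matunit R (r + r) i j) = matunit R r (i - r) j.
Proof.
apply/matrixP => a b; rewrite !mxE /=; congr ((_ && _)%:R); lia.
Qed.

Lemma diag_part_matunit r s i j :
  diag_part (matunit R (r + s) i j) =
  if diag_pos r s (i, j) then matunit R (r + s) i j else 0.
Proof.
apply/matrixP => x y; rewrite (fun_if (fun M : 'M_(r + s) => M x y)).
rewrite -[x]splitK -[y]splitK.
case: (split x) => a; case: (split y) => b; have := ltn_ord a; have := ltn_ord b;
  rewrite /= ?(block_mxEul, block_mxEur, block_mxEdl, block_mxEdr);
  rewrite !mxE /diag_pos /= => ? ?;
  case: ifP => // h; do 4 ?[case: eqP => //= ?]; exfalso; lia.
Qed.

Lemma offdiag_part_matunit r i j :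
  offdiag_part (matunit R (r + r) i j) =
  if offdiag_pos r r (i, j) then matunit R (r + r) i j else 0.
Proof.
apply/matrixP => x y; rewrite (fun_if (fun M : 'M_(r + r) => M x y)).
rewrite -[x]splitK -[y]splitK.
case: (split x) => a; case: (split y) => b; have := ltn_ord a; have := ltn_ord b;
  rewrite /= ?(block_mxEul, block_mxEur, block_mxEdl, block_mxEdr);
  rewrite !mxE /offdiag_pos /= => ? ?;
  case: ifP => // h; do 4 ?[case: eqP => //= ?]; exfalso; lia.
Qed.

Let block_mx_linear m n p q (a : C) (A A' : 'M[C]_(m, n)) (B B' : 'M[C]_(m, q))
    (D D' : 'M[C]_(p, n)) (E E' : 'M[C]_(p, q)) :
  block_mx (a *: A + A') (a *: B + B') (a *: D + D') (a *: E + E') =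
  a *: block_mx A B D E + block_mx A' B' D' E'.
Proof. by rewrite scale_block_mx add_block_mx. Qed.

Lemma submx_linear m n p q :
  [/\ linear (@ulsubmx C m n p q), linear (@ursubmx C m n p q),
      linear (@dlsubmx C m n p q) & linear (@drsubmx C m n p q)].
Proof. by split=> a X Y; apply/matrixP => i j; rewrite !mxE. Qed.

(** Both sides are bilinear in [X] and [Y], so matrix units suffice. For units in the diagonal
    blocks this is the hypothesis on [P]; if one of them lies outside, both sides are 0. *)
Lemma diag_compression_block r s (P : 'M[C]_(tau r + tau s, tau (r + s))) :
  diag_compression lam P -> forall X Y,
  P *m lam (r + s)%N (diag_part X) (diag_part Y) *m adjmx P =
  block_mx (lam r (ulsubmx X) (ulsubmx Y)) 0 0 (lam s (drsubmx X) (drsubmx Y)).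
Proof.
have [ulP _ _ drP] := submx_linear r s r s.
move=> PP; apply: bilinear_delta_ext => [Y a X X'|X a Y Y'|Y a X X'|X a Y Y'|i j i' j'].
- by rewrite linearP linearDl linearZl_LR mulmxDr mulmxDl -scalemxAr -scalemxAl.
- by rewrite linearP linearDr linearZr_LR mulmxDr mulmxDl -scalemxAr -scalemxAl.
- by rewrite ulP drP !linearDl !linearZl_LR -block_mx_linear !scaler0 !addr0.
- by rewrite ulP drP !linearDr !linearZr_LR -block_mx_linear !scaler0 !addr0.
(* The diagonal blocks only depend on [diag_part X], so one case distinction on the position settles
   both sides. *)
have ulE (X : 'M[C]_(r + s)) : ulsubmx X =
    ulsubmx (@diag_part _ r s X) by rewrite block_mxKul.
have drE (X : 'M[C]_(r + s)) : drsubmx X =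
    drsubmx (@diag_part _ r s X) by rewrite block_mxKdr.
rewrite -!matunit_delta.
rewrite (ulE (matunit _ _ i.+1 _)) (ulE (matunit _ _ i'.+1 _)).
rewrite (drE (matunit _ _ i.+1 _)) (drE (matunit _ _ i'.+1 _)) !(diag_part_matunit r s).
have ul0 : ulsubmx (0 : 'M[C]_(r + s)) = 0 by apply/matrixP => x y; rewrite !mxE.
have dr0 : drsubmx (0 : 'M[C]_(r + s)) = 0 by apply/matrixP => x y; rewrite !mxE.
case: ifP => h; last by rewrite ul0 dr0 !linear0l ?mulmx0 ?mul0mx ?block_mx0.
case: ifP => h'; last by rewrite ul0 dr0 !linear0r ?mulmx0 ?mul0mx ?block_mx0.
rewrite !matunit_ul !matunit_dr.
exact: (PP (i.+1, j.+1)%N (i'.+1, j'.+1)%N h h').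
Qed.

Lemma offdiag_compression_block r (P : 'M[C]_(tau r + tau r, tau (r + r))) :
  offdiag_compression lam P -> forall X Y,
  P *m lam (r + r)%N (offdiag_part X) (offdiag_part Y) *m adjmx P =
  block_mx 0 (lam r (ursubmx X) (ursubmx Y)) (lam r (dlsubmx X) (dlsubmx Y)) 0.
Proof.
have [_ urP dlP _] := submx_linear r r r r.
move=> PP; apply: bilinear_delta_ext => [Y a X X'|X a Y Y'|Y a X X'|X a Y Y'|i j i' j'].
- by rewrite linearP linearDl linearZl_LR mulmxDr mulmxDl -scalemxAr -scalemxAl.
- by rewrite linearP linearDr linearZr_LR mulmxDr mulmxDl -scalemxAr -scalemxAl.
- by rewrite urP dlP !linearDl !linearZl_LR -block_mx_linear !scaler0 !addr0.
- by rewrite urP dlP !linearDr !linearZr_LR -block_mx_linear !scaler0 !addr0.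
have urE (X : 'M[C]_(r + r)) : ursubmx X =
    ursubmx (@offdiag_part _ r r X) by rewrite block_mxKur.
have dlE (X : 'M[C]_(r + r)) : dlsubmx X =
    dlsubmx (@offdiag_part _ r r X) by rewrite block_mxKdl.
rewrite -!matunit_delta.
rewrite (urE (matunit _ _ i.+1 _)) (urE (matunit _ _ i'.+1 _)).
rewrite (dlE (matunit _ _ i.+1 _)) (dlE (matunit _ _ i'.+1 _)) !(offdiag_part_matunit r).
have ur0 : ursubmx (0 : 'M[C]_(r + r)) = 0 by apply/matrixP => x y; rewrite !mxE.
have dl0 : dlsubmx (0 : 'M[C]_(r + r)) = 0 by apply/matrixP => x y; rewrite !mxE.
case: ifP => h; last by rewrite ur0 dl0 !linear0l ?mulmx0 ?mul0mx ?block_mx0.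
case: ifP => h'; last by rewrite ur0 dl0 !linear0r ?mulmx0 ?mul0mx ?block_mx0.
rewrite !matunit_ur !matunit_dl.
exact: (PP (i.+1, j.+1)%N (i'.+1, j'.+1)%N h h').
Qed.

Lemma bilinear_polarization k t (f : {bilinear 'M[C]_k -> 'M[C]_k -> 'M[C]_t}) x x' y y' :
  f (x + x') (y + y') + f (x - x') (y - y') = (f x y + f x' y') *+ 2.
Proof.
rewrite !(linearDl, linearDr, linearNl, linearNr).
by apply/matrixP => i j; rewrite mulr2n !mxE; ring.
Qed.

(* The terms mixing a diagonal with an off-diagonal argument, which the
   compression does not control, cancel in the sum. *)
Lemma compression_polarization r (P : 'M[C]_(tau r + tau r, tau (r + r))) :
  diag_compression lam P -> offdiag_compression lam P ->
  forall (A B D E A' B' D' E' : 'M[C]_r),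
  P *m lam (r + r)%N (block_mx A B D E) (block_mx A' B' D' E') *m adjmx P +
  P *m lam (r + r)%N (block_mx A (- B) (- D) E) (block_mx A' (- B') (- D') E')
    *m adjmx P =
  block_mx (lam r A A') (lam r B B') (lam r D D') (lam r E E') *+ 2.
Proof.
move=> Pd Po A B D E A' B' D' E'.
pose X := block_mx A B D E; pose X' := block_mx A' B' D' E'.
have decE (M N O Q : 'M[C]_r) :
    block_mx M N O Q = block_mx M 0 0 Q + block_mx 0 N O 0.
  by rewrite add_block_mx !addr0 !add0r.
have decN (M N O Q : 'M[C]_r) :
    block_mx M (- N) (- O) Q = block_mx M 0 0 Q - block_mx 0 N O 0.
  by rewrite opp_block_mx add_block_mx !oppr0 !addr0 !add0r.
rewrite !decN [block_mx A B D E]decE [block_mx A' B' D' E']decE.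
rewrite -mulmxDl -mulmxDr bilinear_polarization !mulr2n mulmxDr mulmxDl.
have -> : block_mx A 0 0 E = diag_part X by rewrite diag_part_block.
have -> : block_mx A' 0 0 E' = diag_part X' by rewrite diag_part_block.
have -> : block_mx 0 B D 0 = offdiag_part X by rewrite offdiag_part_block.
have -> : block_mx 0 B' D' 0 = offdiag_part X' by rewrite offdiag_part_block.
rewrite mulmxDr mulmxDl diag_compression_block// offdiag_compression_block//.
rewrite !block_mxKul !block_mxKdr !block_mxKur !block_mxKdl.
by rewrite add_block_mx !addr0 !add0r.
Qed.

End Compressions.

Section Biadditive.
Variables (A B : zmodType).
Implicit Type U : zmodType.

Definition biadditive U (F : A -> B -> U) : Prop :=
  (forall w, {morph F^~ w : x y / x + y}) /\ (forall v, {morph F v : x y / x + y}).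

Lemma biadditive0 U : biadditive (fun (_ : A) (_ : B) => 0 : U).
Proof. by split=> ? ? ? /=; rewrite addr0. Qed.

Lemma biadditiveD U (F G : A -> B -> U) : biadditive F -> biadditive G ->
  biadditive (fun v w => F v w + G v w).
Proof.
by move=> [Fl Fr] [Gl Gr]; split=> [w|v] x y /=; rewrite ?(Fl, Fr) ?(Gl, Gr) addrACA.
Qed.

Lemma biadditiveMn U (F : A -> B -> U) k : biadditive F ->
  biadditive (fun v w => F v w *+ k).
Proof. by move=> [Fl Fr]; split=> [w|v] x y /=; rewrite ?(Fl, Fr) mulrnDl. Qed.

End Biadditive.

Lemma biadditive_ext (K : comNzRingType) (V W : lmodType K) m n p q (U : zmodType)
    (F G : 'M[V]_(m, n) -> 'M[W]_(p, q) -> U) :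
  biadditive F -> biadditive G ->
  (forall A x B y, F (matens A x) (matens B y) = G (matens A x) (matens B y)) ->
  forall v w, F v w = G v w.
Proof.
move=> [Fl Fr] [Gl Gr] FG v w; move: v.
apply: (@additive_ext _ _ _ _ _ (F^~ w) (G^~ w)) => // A x.
by move: w; apply: additive_ext => // B y; exact: FG.
Qed.

Section CompressedAmplify.
Variables (K : comNzRingType) (V W U : lmodType K) (b : {bilinear V -> W -> U}).

(** The left factors [a], [A], [B] and the right factors [a'], [A'], [B'] are independent, so that
    the formula also covers the entries off the diagonal of a block matrix. *)
Definition compressed_amplify k t (lam : {bilinear 'M[K]_k -> 'M[K]_k -> 'M[K]_t})
    J J' n m (a : 'M[K]_(n, t)) (A : 'M[K]_(k, J)) (B : 'M[K]_(k, J'))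
    (A' : 'M[K]_(J, k)) (B' : 'M[K]_(J', k)) (a' : 'M[K]_(t, m))
    (s : 'M[V]_J) (t : 'M[W]_J') :=
  mxsandwich a (amplify lam b (mxsandwich A s A') (mxsandwich B t B')) a'.

Lemma compressed_amplify_biadditive k t lam J J' n m a A B A' B' a' :
  biadditive (@compressed_amplify k t lam J J' n m a A B A' B' a').
Proof.
split=> [w|v] x y /=; rewrite /compressed_amplify mxsandwichD.
  by rewrite amplifyDl mxsandwichD.
by rewrite amplifyDr mxsandwichD.
Qed.

Lemma compressed_amplify_matens k t lam J J' n m a A B A' B' a' M x N y :
  @compressed_amplify k t lam J J' n m a A B A' B' a' (matens M x) (matens N y) =
  matens (a *m lam (A *m M *m A') (B *m N *m B') *m a') (b x y).
Proof.
by rewrite /compressed_amplify !mxsandwich_matens amplify_matens mxsandwich_matens.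
Qed.

End CompressedAmplify.

(** The double sum is regrouped into two-by-two arrays with rows [p], [N + p] and columns [q],
    [N + q]. *)
Lemma sum_doubling (U : zmodType) N (F : 'I_(N + N) -> 'I_(N + N) -> U)
    (G G' : 'I_N -> 'I_N -> U) :
  let l := @lshift N N in let u := @rshift N N in
  (forall p q, G p q + G' p q =
     (F (l p) (l q) + F (l p) (u q) + (F (u p) (l q) + F (u p) (u q))) *+ 2) ->
  (\sum_p \sum_q F p q) *+ 2 = \sum_p \sum_q G p q + \sum_p \sum_q G' p q.
Proof.
move=> l u GF; rewrite big_split_ord /= -!big_split /= -sumrMnl.
apply: eq_bigr => p _; rewrite !big_split_ord /= -!big_split /= -sumrMnl.
by apply: eq_bigr => q _; rewrite GF.
Qed.

(** * Direct sums and Schur products under the compressions *)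

Section BlockIdentities.
Variables (R : realType) (tau : nat -> nat)
  (lam : forall k, {bilinear 'M[R[i]]_k -> 'M[R[i]]_k -> 'M[R[i]]_(tau k)}).
Local Notation C := R[i].
Variables (V W U : lmodType C) (b : {bilinear V -> W -> U}).
Local Notation amp k := (amplify (lam k) b).
Local Notation camp k := (compressed_amplify b (lam k)).

Lemma diag_pair r s (P : 'M[C]_(tau r + tau s, tau (r + s))) n m
    (a : 'M[C]_(n, tau r)) (a' : 'M[C]_(n, tau s))
    (d : 'M[C]_(tau r, m)) (d' : 'M[C]_(tau s, m)) A D A' D' :
  diag_compression lam P ->
  (row_mx a a' *m P) *m lam (r + s)%N (block_mx A 0 0 D) (block_mx A' 0 0 D')
    *m (adjmx P *m col_mx d d') =
  a *m lam r A A' *m d + a' *m lam s D D' *m d'.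
Proof.
move=> /diag_compression_block/(_ (block_mx A 0 0 D) (block_mx A' 0 0 D')).
rewrite !diag_part_block !block_mxKul !block_mxKdr => PE.
rewrite mulmxA -!(mulmxA (row_mx a a')) PE mul_block_col !mul0mx addr0 add0r.
by rewrite mul_row_col !mulmxA.
Qed.

(** The two amplifications are obtained from a single one of direct sums. The cross terms between
    [s] and [t'], or [s'] and [t], vanish because each diagonal block of [lam] then has a zero
    argument. *)
Lemma amplify_direct_sum r r' (P : 'M[C]_(tau r + tau r', tau (r + r'))) n m
    (a : 'M[C]_(n, tau r)) (a' : 'M[C]_(n, tau r'))
    (d : 'M[C]_(tau r, m)) (d' : 'M[C]_(tau r', m))
    (s : 'M[V]_r) (t : 'M[W]_r) (s' : 'M[V]_r') (t' : 'M[W]_r') :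
  diag_compression lam P ->
  mxsandwich (row_mx a a' *m P) (amp (r + r')%N
      (mxsandwich (col_mx 1%:M 0) s (row_mx 1%:M 0)
       + mxsandwich (col_mx 0 1%:M) s' (row_mx 0 1%:M))
      (mxsandwich (col_mx 1%:M 0) t (row_mx 1%:M 0)
       + mxsandwich (col_mx 0 1%:M) t' (row_mx 0 1%:M)))
    (adjmx P *m col_mx d d') =
  mxsandwich a (amp r s t) d + mxsandwich a' (amp r' s' t') d'.
Proof.
move=> PP; pose c1 : 'M[C]_(r + r', r) := col_mx 1%:M 0.
pose c2 : 'M[C]_(r + r', r') := col_mx 0 1%:M.
have e1 (A : 'M[C]_r) : c1 *m A *m row_mx 1%:M 0 = block_mx A 0 0 0.
  by rewrite mul_col_mx mul1mx mul0mx mul_col_row !mulmx1 !mulmx0.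
have e2 (A : 'M[C]_r') : c2 *m A *m row_mx 0 1%:M = block_mx 0 0 0 A.
  by rewrite mul_col_mx mul1mx mul0mx mul_col_row !mulmx1 !mulmx0.
pose L := row_mx a a' *m P; pose Q := adjmx P *m col_mx d d'.
have camp_biadd := compressed_amplify_biadditive.
have ampE k p q (g : 'M[C]_(p, tau k)) x y (g' : 'M[C]_(tau k, q)) :
    mxsandwich g (amp k x y) g' = camp k g 1%:M 1%:M 1%:M 1%:M g' x y.
  by rewrite /compressed_amplify -!mxscaleE !mxscale1.
have t11 x y : camp (r + r')%N L c1 c1 (row_mx 1%:M 0) (row_mx 1%:M 0) Q x y =
    camp r a 1%:M 1%:M 1%:M 1%:M d x y.
  move: x y; apply: biadditive_ext => // A x B y.
  rewrite !compressed_amplify_matens !e1 diag_pair// !mul1mx !mulmx1.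
  by rewrite linear0l mulmx0 mul0mx addr0.
have t12 x y : camp (r + r')%N L c1 c2 (row_mx 1%:M 0) (row_mx 0 1%:M) Q x y = 0.
  move: x y; apply: biadditive_ext => // [|A x B y]; first exact: biadditive0.
  rewrite compressed_amplify_matens e1 e2 diag_pair//.
  by rewrite linear0r linear0l !mulmx0 !mul0mx addr0 matens0.
have t21 x y : camp (r + r')%N L c2 c1 (row_mx 0 1%:M) (row_mx 1%:M 0) Q x y = 0.
  move: x y; apply: biadditive_ext => // [|A x B y]; first exact: biadditive0.
  rewrite compressed_amplify_matens e1 e2 diag_pair//.
  by rewrite linear0r linear0l !mulmx0 !mul0mx addr0 matens0.
have t22 x y : camp (r + r')%N L c2 c2 (row_mx 0 1%:M) (row_mx 0 1%:M) Q x y =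
    camp r' a' 1%:M 1%:M 1%:M 1%:M d' x y.
  move: x y; apply: biadditive_ext => // A x B y.
  rewrite !compressed_amplify_matens !e2 diag_pair// !mul1mx !mulmx1.
  by rewrite linear0l mulmx0 mul0mx add0r.
rewrite !(amplifyDl, amplifyDr, mxsandwichD) (ampE r _ _ a) (ampE r' _ _ a') -t11 -t22.
move: (t12 s t') (t21 s' t); rewrite /compressed_amplify => -> ->.
by rewrite addr0 add0r.
Qed.

(** Changing the signs of [A2], [A2'], [B2], [B2'] flips exactly the off-diagonal blocks of both
    arguments, so on elementary tensors this is [compression_polarization] between the row
    [(a1, a2)] and the column [(b1, b2)]. *)
Lemma schur_doubling r J J' n m (P : 'M[C]_(tau r + tau r, tau (r + r)))
    (s : 'M[V]_J) (t : 'M[W]_J')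
    (A1 A2 : 'M[C]_(r, J)) (A1' A2' : 'M[C]_(J, r))
    (B1 B2 : 'M[C]_(r, J')) (B1' B2' : 'M[C]_(J', r))
    (a1 a2 : 'M[C]_(n, tau r)) (b1 b2 : 'M[C]_(tau r, m)) :
  diag_compression lam P -> offdiag_compression lam P ->
  camp (r + r)%N (row_mx a1 a2 *m P) (col_mx A1 A2) (col_mx B1 B2)
    (row_mx A1' A2') (row_mx B1' B2') (adjmx P *m col_mx b1 b2) s t +
  camp (r + r)%N (row_mx a1 a2 *m P) (col_mx A1 (- A2)) (col_mx B1 (- B2))
    (row_mx A1' (- A2')) (row_mx B1' (- B2')) (adjmx P *m col_mx b1 b2) s t =
  (camp r a1 A1 B1 A1' B1' b1 s t + camp r a1 A1 B1 A2' B2' b2 s t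
   + (camp r a2 A2 B2 A1' B1' b1 s t + camp r a2 A2 B2 A2' B2' b2 s t)) *+ 2.
Proof.
have camp_biadd := compressed_amplify_biadditive.
move=> Pd Po; move: s t; apply: biadditive_ext => [||X x Y y].
- exact: biadditiveD.
- by apply: biadditiveMn; apply: biadditiveD; apply: biadditiveD.
rewrite !compressed_amplify_matens.
have cr J0 (M1 M2 : 'M[C]_(r, J0)) Z (M1' M2' : 'M[C]_(J0, r)) :
    col_mx M1 M2 *m Z *m row_mx M1' M2' =
    block_mx (M1 *m Z *m M1') (M1 *m Z *m M2') (M2 *m Z *m M1') (M2 *m Z *m M2').
  by rewrite mul_col_mx mul_col_row.
rewrite !cr !mulNmx !mulmxN !opprK.
have := compression_polarization Pd Po (A1 *m X *m A1') (A1 *m X *m A2')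
  (A2 *m X *m A1') (A2 *m X *m A2') (B1 *m Y *m B1') (B1 *m Y *m B2')
  (B2 *m Y *m B1') (B2 *m Y *m B2').
move/(congr1 (fun M => row_mx a1 a2 *m M *m col_mx b1 b2)).
rewrite mulr2n !(mulmxDr, mulmxDl) -(mulmxA _ (block_mx _ _ _ _)).
rewrite mul_block_col mul_row_col.
rewrite !(mulmxDr, mulmxA) => E.
exact: matens_polarization E.
Qed.

(** Trades the number of rows for the level: a sum with [N + N] rows at level [r] becomes, up to the
    factor 2, two sums with [N] rows at level [r + r]. *)
Lemma schur_sum_doubling r J J' n m (P : 'M[C]_(tau r + tau r, tau (r + r))) N
    (s : 'M[V]_J) (t : 'M[W]_J')
    (A : 'I_(N + N) -> 'M[C]_(r, J)) (A' : 'I_(N + N) -> 'M[C]_(J, r))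
    (B : 'I_(N + N) -> 'M[C]_(r, J')) (B' : 'I_(N + N) -> 'M[C]_(J', r))
    (a : 'I_(N + N) -> 'M[C]_(n, tau r)) (a' : 'I_(N + N) -> 'M[C]_(tau r, m)) :
  diag_compression lam P -> offdiag_compression lam P ->
  (\sum_p \sum_q camp r (a p) (A p) (B p) (A' q) (B' q) (a' q) s t) *+ 2 =
  let l (p : 'I_N) := lshift N p in let u (p : 'I_N) := rshift N p in
  let al p := row_mx (a (l p)) (a (u p)) *m P in
  let al' p := adjmx P *m col_mx (a' (l p)) (a' (u p)) in
  \sum_p \sum_q camp (r + r)%N (al p) (col_mx (A (l p)) (A (u p)))
    (col_mx (B (l p)) (B (u p))) (row_mx (A' (l q)) (A' (u q)))
    (row_mx (B' (l q)) (B' (u q))) (al' q) s t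
  + \sum_p \sum_q camp (r + r)%N (al p) (col_mx (A (l p)) (- A (u p)))
    (col_mx (B (l p)) (- B (u p))) (row_mx (A' (l q)) (- A' (u q)))
    (row_mx (B' (l q)) (- B' (u q))) (al' q) s t.
Proof.
by move=> Pd Po; apply: sum_doubling => p q; exact: schur_doubling.
Qed.

Lemma schur_sum_ext r J J' n m N M (s : 'M[V]_J) (t : 'M[W]_J')
    (A : 'I_(N + M) -> 'M[C]_(r, J)) (A' : 'I_(N + M) -> 'M[C]_(J, r))
    (B : 'I_(N + M) -> 'M[C]_(r, J')) (B' : 'I_(N + M) -> 'M[C]_(J', r))
    (a : 'I_(N + M) -> 'M[C]_(n, tau r)) (a' : 'I_(N + M) -> 'M[C]_(tau r, m)) :
  (forall p, a (rshift N p) = 0) -> (forall p, a' (rshift N p) = 0) ->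
  \sum_p \sum_q camp r (a p) (A p) (B p) (A' q) (B' q) (a' q) s t =
  \sum_(p < N) \sum_(q < N) camp r (a (lshift M p)) (A (lshift M p)) (B (lshift M p))
    (A' (lshift M q)) (B' (lshift M q)) (a' (lshift M q)) s t.
Proof.
move=> ar a'r; rewrite big_split_ord /= [X in _ + X]big1 ?addr0 => [|p _].
  apply: eq_bigr => p _; rewrite big_split_ord /= [X in _ + X]big1 ?addr0// => q _.
  by rewrite /compressed_amplify a'r mxsandwich0r.
by rewrite big1// => q _; rewrite /compressed_amplify ar mxsandwich0l.
Qed.

End BlockIdentities.

(** * The cones of the tensor product *)

Section PreCone.
Variables (R : realType) (tau : nat -> nat)
  (lam : forall k, {bilinear 'M[R[i]]_k -> 'M[R[i]]_k -> 'M[R[i]]_(tau k)}).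
Variables S T : operator_system R.
Local Notation C := R[i].
Local Notation pcone n := (@pre_cone R tau lam S T n).

Hypotheses (lamN1 : condN1 tau) (lamE2 : condE2 lam)
  (lam1 : lam 1 1%:M 1%:M = 1%:M).

Lemma pre_cone_sandwich n m (B : 'M[C]_(m, n)) v :
  pcone n v -> pcone m (mxsandwich B v (adjmx B)).
Proof.
move=> [j [s [t [a [j0 ps pt ->]]]]]; exists j, s, t, (B *m a); split=> //.
by rewrite mxsandwichA adjmxM.
Qed.

Lemma pre_coneD n v w : pcone n v -> pcone n w -> pcone n (v + w).
Proof.
move=> [r [s [t [a [r0 ps pt ->]]]]] [r' [s' [t' [a' [r'0 ps' pt' ->]]]]].
have [P [_ PP]] := lamE2 r0 r'0.
pose c1 : 'M[C]_(r + r', r) := col_mx 1%:M 0.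
pose c2 : 'M[C]_(r + r', r') := col_mx 0 1%:M.
have c1E : adjmx c1 = row_mx 1%:M 0.
  by rewrite adjmx_col_mx adjmx_scalar adjmx0 conjc1.
have c2E : adjmx c2 = row_mx 0 1%:M.
  by rewrite adjmx_col_mx adjmx_scalar adjmx0 conjc1.
(* The direct sums of [s], [s'] and of [t], [t'], compressed by the row [(a, a')] times the matrix
   [P] of (E2). *)
exists (r + r')%N, (mxsandwich c1 s (adjmx c1) + mxsandwich c2 s' (adjmx c2)),
  (mxsandwich c1 t (adjmx c1) + mxsandwich c2 t' (adjmx c2)), (row_mx a a' *m P).
have rr0 : (0 < r + r')%N by rewrite addn_gt0 r0.
split=> //; try by apply: coneD => //; exact: cone_sandwich.
by rewrite adjmxM adjmx_row_mx c1E c2E amplify_direct_sum.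
Qed.

(* As tau 1 = 1 is not a conversion, the compression is written as a matrix all of
   whose columns, in number tau 1, are b. *)
Lemma pre_cone_matens n (b : 'cV[C]_n) (s : S) (t : T) :
  pos1 s -> pos1 t -> pcone n (matens (b *m adjmx b) (tens s t)).
Proof.
move=> ps pt; exists 1, (const_mx s), (const_mx t), (\matrix_(i, j) b i 0).
split=> //.
have cE (V : lmodType C) (x : V) : const_mx x = matens (1%:M : 'M_1) x.
  by apply/matrixP => i j; rewrite !mxE !ord1 eqxx scale1r.
rewrite !cE amplify_matens lam1 mxsandwich_matens mulmx1; congr matens.
apply/matrixP => i j; rewrite !mxE big_ord1.
under [RHS]eq_bigr => k _ do rewrite !mxE.
by rewrite sumr_const card_ord lamN1 !mxE.
Qed.

Lemma pre_cone0 n : pcone n 0.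
Proof.
have := @pre_cone_matens n 0 _ _ (pos1_unit S) (pos1_unit T).
by rewrite mul0mx matens0.
Qed.

Lemma pre_cone_sum n (I : Type) (r : seq I) (P : pred I) F :
  (forall i, P i -> pcone n (F i)) -> pcone n (\sum_(i <- r | P i) F i).
Proof. by move=> PF; elim/big_ind: _ => //; [exact: pre_cone0|exact: pre_coneD]. Qed.

(** Scaling by [r] is the compression by the scalar matrix of the square root of [r]. *)
Lemma pre_coneZ n (r : R) v : 0 <= r -> pcone n v -> pcone n (mxscale r%:C v).
Proof.
move=> r0 /(pre_cone_sandwich (Num.sqrt r)%:C%:M).
rewrite adjmx_scalar conjcR.
suff -> : mxsandwich ((Num.sqrt r)%:C)%:M v ((Num.sqrt r)%:C)%:M = mxscale r%:C v by [].
move: v; apply: additive_ext => [v w|v w|A x].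
- by rewrite mxsandwichD.
- by rewrite mxscaleE mxsandwichD -!mxscaleE.
rewrite mxscaleE !mxsandwich_matens !mul_scalar_mx mulmx1 -scalemxAl mul_mx_scalar.
by rewrite scalerA -rmorphM -expr2 sqr_sqrtr.
Qed.

Lemma diag_cst_matens (V : lmodType C) n (x : V) : diag_cst n x = matens 1%:M x.
Proof. by apply/matrixP => i j; rewrite !mxE; case: eqP; rewrite ?scale1r ?scale0r. Qed.

Lemma matens_sum (V : lmodType C) m n (I : Type) (r : seq I) (P : pred I)
    (F : I -> 'M[C]_(m, n)) (x : V) :
  matens (\sum_(i <- r | P i) F i) x = \sum_(i <- r | P i) matens (F i) x.
Proof.
apply: (big_morph (fun A => matens A x)) => [A B|]; [exact: matensDl|exact: matens0].
Qed.

(** The identity matrix is a sum of rank-one projections, each covered by [pre_cone_matens]. *)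
Lemma pre_cone_diag n (s : S) (t : T) : pos1 s -> pos1 t ->
  pcone n (diag_cst n (tens s t)).
Proof.
move=> ps pt.
rewrite diag_cst_matens mx1_sum_delta matens_sum; apply: pre_cone_sum => i _.
have -> : delta_mx i i = (delta_mx i 0 : 'cV[C]_n) *m adjmx (delta_mx i 0 : 'cV[C]_n).
  by rewrite adjmx_delta mul_delta_mx.
exact: pre_cone_matens.
Qed.

End PreCone.

Lemma adjmxZ (R : realType) m n a (A : 'M[R[i]]_(m, n)) :
  adjmx (a *: A) = (a^*)%C *: adjmx A.
Proof. by apply/matrixP => i j; rewrite !(adjmxE, mxE) rmorphM. Qed.

(** * The involution, and Schur products of positive elements *)

Section TensorCones.
Variables (R : realType) (tau : nat -> nat)
  (lam : forall k, {bilinear 'M[R[i]]_k -> 'M[R[i]]_k -> 'M[R[i]]_(tau k)}).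
Variables S T : operator_system R.
Local Notation C := R[i].
Local Notation amp k := (amplify (lam k) (@tens C S T)).
Local Notation camp k := (compressed_amplify (@tens C S T) (lam k)).
Local Notation pcone n := (@pre_cone R tau lam S T n).

Hypotheses (lamN1 : condN1 tau) (lamE2 : condE2 lam)
  (lam1 : lam 1 1%:M 1%:M = 1%:M) (lamO1 : condO1 lam) (lamO2 : condO2 lam).

Implicit Type D : forall n, set 'M[tensor S T]_n.

(** Both sides are conjugate-linear in each argument; after one more adjoint they are bilinear, and
    (O1) settles the matrix units. *)
Lemma lam_adjmx k (A B : 'M[C]_k) : (0 < k)%N ->
  lam k (adjmx A) (adjmx B) = adjmx (lam k A B).
Proof.
move=> k0; rewrite -[LHS]adjmxK; congr adjmx; move: A B.
apply: bilinear_delta_ext => [Y a X X'|X a Y Y'|Y a X X'|X a Y Y'|i j i' j'].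
- by rewrite adjmxD adjmxZ linearDl linearZl_LR adjmxD adjmxZ conjcK.
- by rewrite adjmxD adjmxZ linearDr linearZr_LR adjmxD adjmxZ conjcK.
- by rewrite linearDl linearZl_LR.
- by rewrite linearDr linearZr_LR.
by rewrite !adjmx_delta -lamO1.
Qed.

Lemma tens_starE D s t :
  @sys_star R (tens_system D) (tens s t : tensor S T) = tens (sys_star s) (sys_star t).
Proof.
rewrite /= tens_liftE// => [v v' w|v w w'|a v w]; rewrite ?sys_starD ?sys_starZ.
- by rewrite linearDl.
- by rewrite linearDr.
- by rewrite linearZl_LR linearZr_LR.
Qed.

Lemma tens_starD D (x y : tensor S T) :
  @sys_star R (tens_system D) (x + y) =
  @sys_star R (tens_system D) x + @sys_star R (tens_system D) y.
Proof.
rewrite /= tens_liftD// => [v v' w|v w w'|a v w]; rewrite ?sys_starD ?sys_starZ.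
- by rewrite linearDl.
- by rewrite linearDr.
- by rewrite linearZl_LR linearZr_LR.
Qed.

Lemma tensor_ind (P : tensor S T -> Prop) : P 0 ->
  (forall x y, P x -> P y -> P (x + y)) ->
  (forall s t, P (tens s t)) -> forall x, P x.
Proof. by move=> P0 PD Pt x; rewrite [x]tensE; elim/big_ind: _ => // *; exact: PD. Qed.

Lemma tens_star0 D : @sys_star R (tens_system D) (0 : tensor S T) = 0.
Proof.
by apply: (addrI (@sys_star R (tens_system D) 0)); rewrite -tens_starD !addr0.
Qed.

Lemma tens_starZ D a (x : tensor S T) :
  @sys_star R (tens_system D) (a *: x) = (a^*)%C *: @sys_star R (tens_system D) x.
Proof.
elim/tensor_ind: x => [|x y xE yE|s t]; first by rewrite scaler0 tens_star0 scaler0.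
  by rewrite scalerDr !tens_starD xE yE scalerDr.
by rewrite -linearZl_LR !tens_starE sys_starZ linearZl_LR.
Qed.

Lemma tens_system_involution D : is_involution (tens_system D).
Proof.
split=> [x|a x y]; last by rewrite tens_starD tens_starZ.
elim/tensor_ind: x => [|x y xE yE|s t]; first by rewrite !tens_star0.
  by rewrite !tens_starD xE yE.
by rewrite !tens_starE !sys_starK.
Qed.

Lemma mxstar_tensD D n : {morph @mxstar R (tens_system D) n : v w / v + w}.
Proof. by move=> v w; apply/matrixP => i j; rewrite !mxE tens_starD. Qed.

Lemma mxstar_matens D n (A : 'M[C]_n) (x : tensor S T) :
  @mxstar R (tens_system D) n (matens A x) =
  matens (adjmx A) (@sys_star R (tens_system D) x).
Proof. by apply/matrixP => i j; rewrite !mxE tens_starZ. Qed.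

Lemma pre_cone_star D n (v : 'M[tensor S T]_n) : pcone n v ->
  @mxstar R (tens_system D) n v = v.
Proof.
move=> [k [s [t [a [k0 ps pt ->]]]]].
have [_ [sS _ _] _] := operator_systemP S.
have [_ [sT _ _] _] := operator_systemP T.
(* With [s] and [t] replaced by their adjoints on the right, the identity holds for all [s] and [t];
   elementary tensors then suffice. *)
rewrite -{2}(sS _ _ k0 ps) -{2}(sT _ _ k0 pt); move: s t {ps pt}.
apply: biadditive_ext => [||A x B y].
- split=> ? x y /=; first by rewrite amplifyDl mxsandwichD mxstar_tensD.
  by rewrite amplifyDr mxsandwichD mxstar_tensD.
- split=> ? x y /=; rewrite mxstarD; first by rewrite amplifyDl mxsandwichD.
  by rewrite amplifyDr mxsandwichD.
have sE (X : operator_system R) (z : X) (M : 'M[C]_k) :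
    mxstar (matens M z) = matens (adjmx M) (sys_star z).
  by apply/matrixP => i j; rewrite !mxE sys_starZ.
rewrite !sE !(amplify_matens, mxsandwich_matens) mxstar_matens tens_starE lam_adjmx//.
by rewrite !adjmxM adjmxK mulmxA.
Qed.

(* The compression by the row (a_p) of the N x N block matrix with blocks
   lam_r(s_pq, t_pq), where s_pq = A_p s A_q^* and t_pq = B_p t B_q^*. *)
Definition schur_sum_in_cone N := forall r J J' n (s : 'M[S]_J) (t : 'M[T]_J')
    (A : 'I_N -> 'M[C]_(r, J)) (B : 'I_N -> 'M[C]_(r, J'))
    (a : 'I_N -> 'M[C]_(n, tau r)),
  (0 < r)%N -> (0 < J)%N -> (0 < J')%N -> sys_cone s -> sys_cone t ->
  pcone n (\sum_p \sum_q camp r (a p) (A p) (B p)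
    (adjmx (A q)) (adjmx (B q)) (adjmx (a q)) s t).

Lemma schur_sum1 : schur_sum_in_cone 1.
Proof.
move=> r J J' n s t A B a r0 J0 J0' ps pt; rewrite !big_ord1.
exists r, (mxsandwich (A 0) s (adjmx (A 0))), (mxsandwich (B 0) t (adjmx (B 0))).
by exists (a 0); split=> //; exact: cone_sandwich.
Qed.

(** Twice the sum splits into two Schur sums with [N] rows at level [r + r], the signs being
    absorbed into [A] and [B]; halving stays in the cone. *)
Lemma schur_sum_double N : schur_sum_in_cone N -> schur_sum_in_cone (N + N).
Proof.
move=> IH r J J' n s t A B a r0 J0 J0' ps pt.
have [P [_ Pd Po]] := lamO2 r0.
have rr0 : (0 < r + r)%N by rewrite addn_gt0 r0.
set v := \sum_p _.
rewrite -[v]mxscale_half.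
apply: pre_coneZ; first by rewrite invr_ge0.
rewrite (schur_sum_doubling (@tens C S T) s t A (fun q => adjmx (A q))
  B (fun q => adjmx (B q)) a (fun q => adjmx (a q)) Pd Po) /=.
by apply: pre_coneD => //; under eq_bigr => p _ do under eq_bigr => q _ do
  rewrite -?adjmxN -!adjmx_col_mx -adjmx_row_mx -adjmxM; exact: IH.
Qed.

(** The families are padded with zero matrices, whose terms vanish. *)
Lemma schur_sum_le N M : (N <= M)%N -> schur_sum_in_cone M -> schur_sum_in_cone N.
Proof.
move=> /subnKC<-; move: (M - N)%N => {}M IH r J J' n s t A B a r0 J0 J0' ps pt.
pose ext U (z : U) (F : 'I_N -> U) (p : 'I_(N + M)) :=
  match split p with inl q => F q | inr _ => z end.
have extl U (z : U) F p : ext U z F (lshift M p) = F p.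
  by rewrite /ext -[lshift M p]/(unsplit (inl p)) unsplitK.
have extr U (z : U) F p : ext U z F (rshift N p) = z.
  by rewrite /ext -[rshift N p]/(unsplit (inr p)) unsplitK.
have := IH r J J' n s t (ext _ 0 A) (ext _ 0 B) (ext _ 0 a) r0 J0 J0' ps pt.
rewrite schur_sum_ext => [|p|p]; rewrite ?extr ?adjmx0//.
by under eq_bigr => p _ do under eq_bigr => q _ do rewrite !extl.
Qed.

Lemma schur_sum N : schur_sum_in_cone N.
Proof.
suff pow k : schur_sum_in_cone (2 ^ k).
  by apply: schur_sum_le (pow N); rewrite ltnW// ltn_expl.
elim: k => [|k IH]; first exact: schur_sum1.
by rewrite expnS mul2n -addnn; exact: schur_sum_double.
Qed.

Lemma pre_cone_tensmx k l (P : 'M[S]_k) (Q : 'M[T]_l) : (0 < k)%N -> (0 < l)%N ->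
  sys_cone P -> sys_cone Q -> pcone (k * l)%N (tensmx_tens P Q).
Proof.
move=> k0 l0 cP cQ.
(* For [p = (i, i')] and [q = (j, j')] the entry of the Kronecker product is the tensor of [P i j]
   and [Q i' j']: a Schur sum at level 1, in which [A p] and [B p] select the rows [i] and [i'] and
   [a p] puts the result in row [p]. *)
pose A (p : 'I_(k * l)) : 'M[C]_(1, k) := delta_mx 0 (mxtens_unindex p).1.
pose B (p : 'I_(k * l)) : 'M[C]_(1, l) := delta_mx 0 (mxtens_unindex p).2.
pose a (p : 'I_(k * l)) : 'M[C]_(k * l, tau 1) := \matrix_(x, y) (x == p)%:R.
suff -> : tensmx_tens P Q = \sum_p \sum_q camp 1 (a p) (A p) (B p)
    (adjmx (A q)) (adjmx (B q)) (adjmx (a q)) P Q by exact: schur_sum.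
have entry (X : operator_system R) m (V : 'M[X]_m) i j :
    mxsandwich (delta_mx 0 i : 'rV_m) V (adjmx (delta_mx 0 j : 'rV_m)) =
    matens 1%:M (V i j).
  rewrite adjmx_delta; move: V; apply: additive_ext => [V W|V W|M x].
  - by rewrite mxsandwichD.
  - by rewrite mxE matensDr.
  rewrite mxsandwich_matens mxE matensZ; congr matens.
  by apply/matrixP => x' y'; rewrite !ord1 -rowE -colE !mxE eqxx mulr1.
rewrite [LHS]mx_matens; apply: eq_bigr => p _; apply: eq_bigr => q _.
rewrite /compressed_amplify !entry amplify_matens lam1 mxsandwich_matens mulmx1 mxE.
congr matens; apply/matrixP => x y; rewrite !mxE.
under eq_bigr => z _ do rewrite !mxE.
rewrite sumr_const card_ord lamN1 mulr1n.
by rewrite rmorph_nat -natrM mulnb.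
Qed.

End TensorCones.

Section ScaledMatrices.
Variables (R : realType) (V : lmodType R[i]).
Local Notation C := R[i].
Variables m n : nat.
Implicit Types (r : R) (v w e : 'M[V]_(m, n)).

Lemma mxscaleDl r r' v : mxscale (r + r')%:C v = mxscale r%:C v + mxscale r'%:C v.
Proof. by apply/matrixP => i j; rewrite !mxE rmorphD scalerDl. Qed.

Lemma mxscaleDr (a : C) v w : mxscale a (v + w) = mxscale a v + mxscale a w.
Proof. by apply/matrixP => i j; rewrite !mxE scalerDr. Qed.

Lemma mxscaleN (a : C) v : mxscale a (- v) = - mxscale a v.
Proof. by apply/matrixP => i j; rewrite !mxE scalerN. Qed.

Lemma mxscaleA (a b : C) v : mxscale a (mxscale b v) = mxscale (a * b) v.
Proof. by apply/matrixP => i j; rewrite !mxE scalerA. Qed.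

Lemma mxscaleC (r r' : R) v : mxscale r%:C (mxscale r'%:C v) = mxscale (r * r')%:C v.
Proof. by rewrite mxscaleA -rmorphM. Qed.

Lemma mxscale_subD r r' e v w :
  mxscale (r + r')%:C e - (v + w) = (mxscale r%:C e - v) + (mxscale r'%:C e - w).
Proof. by rewrite mxscaleDl opprD addrACA. Qed.

Lemma mxscale_addD r r' e v w :
  mxscale (r + r')%:C e + (v + w) = (mxscale r%:C e + v) + (mxscale r'%:C e + w).
Proof. by rewrite mxscaleDl addrACA. Qed.

Lemma mxscale_split r e v :
  mxscale r%:C e + v = mxscale (r / 2)%:C e + (mxscale (r / 2)%:C e + v).
Proof. by rewrite addrA -mxscaleDl -splitr. Qed.

Lemma mxscale0 v : mxscale 0%:C v = 0.
Proof. by apply/matrixP => i j; rewrite !mxE scale0r. Qed.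

Lemma mxsandwich_scale p q (a : C) (A : 'M[C]_(p, m)) v (B : 'M[C]_(n, q)) :
  mxsandwich A (mxscale a v) B = mxscale a (mxsandwich A v B).
Proof. by rewrite !mxscaleE !mxsandwichA mulmx1 mul1mx mul_scalar_mx mul_mx_scalar. Qed.

End ScaledMatrices.

(** A self-adjoint [h] is the difference of the positive elements [r 1] and [r 1 - h], and every
    element is a combination of two self-adjoint ones. *)
Lemma span_pos1 (R : realType) (X : operator_system R) (Q : X -> Prop) :
  (forall x y, Q x -> Q y -> Q (x + y)) -> (forall a x, Q x -> Q (a *: x)) ->
  (forall x, pos1 x -> Q x) -> forall x, Q x.
Proof.
move=> QD QZ Qp.
have Qsa h : sys_star h = h -> Q h.
  move=> /pos1_order_unit[r r0 pr].
  rewrite -(subKr (r%:C *: sys_unit X) h); apply: QD.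
    by apply/Qp/pos1Z; [exact: ltW|exact: pos1_unit].
  by rewrite -scaleN1r; apply/QZ/Qp.
move=> x.
have -> : x = (2^-1)%:C *: ((x + sys_star x) + (- 'i) *: ('i *: (x - sys_star x))).
  rewrite scalerA mulNr -expr2 sqr_i opprK scale1r addrACA subrr addr0.
  rewrite -mulr2n -scaler_nat scalerA -(rmorph_nat (real_complex R)) -rmorphM.
  by rewrite mulVf ?pnatr_eq0// scale1r.
apply/QZ/QD; first exact/Qsa/sys_star_re.
exact/QZ/Qsa/sys_star_im.
Qed.

(** * Order unit and Archimedean closure *)

Section LambdaCone.
Variables (R : realType) (tau : nat -> nat)
  (lam : forall k, {bilinear 'M[R[i]]_k -> 'M[R[i]]_k -> 'M[R[i]]_(tau k)}).
Variables S T : operator_system R.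
Local Notation C := R[i].
Local Notation pcone n := (@pre_cone R tau lam S T n).
Local Notation lcone n := (@lambda_cone R tau lam S T n).
Local Notation one n := (diag_cst n (tens (sys_unit S) (sys_unit T))).
Implicit Type D : forall n, set 'M[tensor S T]_n.

Hypotheses (lamN1 : condN1 tau) (lamE2 : condE2 lam)
  (lam1 : lam 1 1%:M 1%:M = 1%:M) (lamO1 : condO1 lam).

Let pD n := @pre_coneD _ _ _ S T lamE2 n.
Let pZ n := @pre_coneZ R tau lam S T n.
Let p_unit n := @pre_cone_diag _ _ _ S T lamN1 lamE2 lam1 n.

Lemma pre_cone_one n (r : R) : 0 <= r -> pcone n (mxscale r%:C (one n)).
Proof. by move=> r0; apply: pZ => //; apply: p_unit; exact: pos1_unit. Qed.

(** Domination is taken in the order of the cones before the Archimedean closure, where witnesses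
    can be written down. *)
Definition bounded n (w : 'M[tensor S T]_n) : Prop :=
  exists2 r : R, 0 < r & pcone n (mxscale r%:C (one n) - w).

Lemma boundedD n (v w : 'M[tensor S T]_n) : bounded v -> bounded w -> bounded (v + w).
Proof.
move=> [r r0 pv] [r' r'0 pw]; exists (r + r'); first exact: addr_gt0.
by rewrite mxscale_subD; exact: pD.
Qed.

Lemma boundedN n (w : 'M[tensor S T]_n) : pcone n w -> bounded (- w).
Proof.
move=> pw; exists 1; first exact: ltr01.
by rewrite opprK; apply: pD => //; exact: pre_cone_one.
Qed.

Lemma bounded_diag n (s : S) (t : T) : pos1 s -> pos1 t ->
  bounded (diag_cst n (tens s t)).
Proof.
move=> ps pt.
have [r r0 pr] := pos1_order_unit (pos1_star ps).
have [r' r'0 pr'] := pos1_order_unit (pos1_star pt).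
exists (r * r'); first exact: mulr_gt0.
(* Telescoping: [r r' (1 (x) 1) - s (x) t = (r 1 - s) (x) r' 1 + s (x) (r' 1 - t)]. *)
have -> : mxscale (r * r')%:C (one n) - diag_cst n (tens s t) =
    diag_cst n (tens (r%:C *: sys_unit S - s) (r'%:C *: sys_unit T)) +
    diag_cst n (tens s (r'%:C *: sys_unit T - t)).
  rewrite !diag_cst_matens -matensDr; apply/matrixP => i j; rewrite !mxE.
  rewrite scalerA mulrC -scalerA -scalerBr; congr (_ *: _).
  rewrite linearBl linearBr subrKA linearZl_LR linearZr_LR /=.
  by rewrite rmorphM -scalerA.
apply: pD; apply: p_unit => //.
by apply: pos1Z; [exact: ltW|exact: pos1_unit].
Qed.

Lemma bounded_delta n (i : 'I_n) (s : S) (t : T) : pos1 s -> pos1 t ->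
  bounded (matens (delta_mx i i) (tens s t)).
Proof.
move=> ps pt.
(* One diagonal unit is the identity minus the others, and negatives of cone elements are
   bounded. *)
have -> : matens (delta_mx i i) (tens s t) = diag_cst n (tens s t) +
    - (\sum_(k | k != i) matens (delta_mx k k) (tens s t)).
  by rewrite diag_cst_matens mx1_sum_delta matens_sum (bigD1 i)//= addrK.
apply: boundedD; first exact: bounded_diag.
apply: boundedN; apply: pre_cone_sum => // k _.
have -> : delta_mx k k = (delta_mx k 0 : 'cV[C]_n) *m adjmx (delta_mx k 0 : 'cV[C]_n).
  by rewrite adjmx_delta mul_delta_mx.
exact: pre_cone_matens.
Qed.

Lemma bounded_hermitian_delta n (i j : 'I_n) (c : C) (s : S) (t : T) :
  pos1 s -> pos1 t ->
  bounded (matens (c *: delta_mx i j + c^*%C *: delta_mx j i) (tens s t)).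
Proof.
move=> ps pt.
(* Completing the square: the mixed terms of [b *m adjmx b] are the negative of the given hermitian
   matrix, and the remaining terms are diagonal. *)
pose b : 'cV[C]_n := delta_mx i 0 - c^*%C *: delta_mx j 0.
have bE : c *: delta_mx i j + c^*%C *: delta_mx j i =
    delta_mx i i + (c * c^*%C) *: delta_mx j j - b *m adjmx b.
  rewrite /b adjmxD adjmxN adjmxZ !adjmx_delta conjcK mulmxBl !mulmxBr.
  rewrite -!scalemxAl -!scalemxAr !mul_delta_mx scalerA [c^*%C * c]mulrC.
  by apply/matrixP => x y; rewrite !mxE; ring.
have -> : matens (c *: delta_mx i j + c^*%C *: delta_mx j i) (tens s t) =
    matens (delta_mx i i) (tens s t)
    + matens (delta_mx j j) (tens ((c * c^*%C) *: s) t)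
    + - matens (b *m adjmx b) (tens s t).
  rewrite bE linearZl_LR matensZ -!matensDl; apply/matrixP => x y.
  by rewrite !mxE scalerDl scaleNr.
apply: boundedD; last by apply: boundedN; exact: pre_cone_matens.
apply: boundedD; first exact: bounded_delta.
apply: bounded_delta => //.
have := mulcJ_ge0 c; case: (c * _) => a b'; rewrite lecE /= => /andP[/eqP-> a0].
exact: (pos1Z a0 ps).
Qed.

Lemma bounded_self_adjoint D n (v : 'M[tensor S T]_n) :
  @mxstar R (tens_system D) n v = v -> bounded v.
Proof.
pose star := @mxstar R (tens_system D) n => vE.
(* Symmetrization makes the property additive in [w] and meaningful for every [w]; at half of a
   self-adjoint [v] it says that [v] is bounded. *)
pose W (w : 'M[tensor S T]_n) := bounded (w + star w).
have WD w w' : W w -> W w' -> W (w + w').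
  by rewrite /W /star mxstar_tensD addrACA; exact: boundedD.
have W0 : W 0.
  rewrite /W /star.
  have -> : @mxstar R (tens_system D) n 0 = 0.
    by apply/matrixP => i j; rewrite !mxE tens_star0.
  rewrite addr0 -oppr0; apply: boundedN; exact: pre_cone0.
(* Generality in [c] lets the matrix coefficient absorb the complex scalars met when [x] and [y] are
   reduced to positive elements. *)
have Wd i j c x y : W (matens (c *: delta_mx i j) (tens x y)).
  move: c; elim/span_pos1: x => [x x' Wx Wx' c|a x Wx c|s ps c].
  - by rewrite linearDl matensDr; apply: WD; [exact: Wx|exact: Wx'].
  - by rewrite linearZl_LR matensZ scalerA; exact: Wx.
  move: c; elim/span_pos1: y => [y y' Wy Wy' c|a y Wy c|t pt c].
  - by rewrite linearDr matensDr; apply: WD; [exact: Wy|exact: Wy'].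
  - by rewrite linearZr_LR matensZ scalerA; exact: Wy.
  rewrite /W /star mxstar_matens tens_starE !pos1_star// adjmxZ adjmx_delta -matensDl.
  exact: bounded_hermitian_delta.
have Wall w : W w.
  rewrite [w]mx_matens; elim/big_ind: _ => // i _; elim/big_ind: _ => // j _.
  elim/tensor_ind: (w i j) => [|x y Wx Wy|x y]; first by rewrite matens0r.
    by rewrite matensDr; exact: WD.
  by rewrite -[delta_mx i j]scale1r; exact: Wd.
have := Wall (mxscale (2^-1)%:C v); rewrite /W.
have -> : star (mxscale (2^-1)%:C v) = mxscale (2^-1)%:C v.
  apply/matrixP => i j; rewrite !mxE tens_starZ conjcR; congr (_ *: _).
  by move/matrixP/(_ i j): vE; rewrite !mxE.
by rewrite -mxscaleDr -mulr2n mxscale_half.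
Qed.

Lemma pre_cone_lambda n v : pcone n v -> lcone n v.
Proof. by move=> pv r r0; apply: pD => //; apply: pre_cone_one; exact: ltW. Qed.

Lemma lambda_cone_star D n v : lcone n v -> @mxstar R (tens_system D) n v = v.
Proof.
move=> /(_ 1 ltr01) /(pre_cone_star lamO1 D); rewrite mxstar_tensD.
by rewrite (pre_cone_star lamO1 D) => [/addrI//|]; apply: pre_cone_one; exact: ler01.
Qed.

Lemma lambda_coneD n v w : lcone n v -> lcone n w -> lcone n (v + w).
Proof.
move=> lv lw r r0; rewrite [r]splitr mxscale_addD.
by apply: pD; [apply: lv|apply: lw]; rewrite divr_gt0.
Qed.

Lemma lambda_coneZ n (r : R) v : 0 <= r -> lcone n v -> lcone n (mxscale r%:C v).
Proof.
rewrite le_eqVlt => /predU1P[<- _ s s0|r0 lv s s0].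
  by rewrite mxscale0 addr0; apply: pre_cone_one; exact: ltW.
have -> : mxscale s%:C (one n) + mxscale r%:C v =
    mxscale r%:C (mxscale (s / r)%:C (one n) + v).
  by rewrite mxscaleDr mxscaleC mulrC divfK ?gt_eqF.
by apply: pZ; [exact: ltW|apply: lv; rewrite divr_gt0].
Qed.

(** Half of [r] is spent on the hypothesis, the other half on the definition of the closed cone. *)
Lemma lambda_cone_archimedean n v :
  (forall s : R, 0 < s -> lcone n (mxscale s%:C (one n) + v)) -> lcone n v.
Proof.
move=> lv r r0; have r20 : 0 < r / 2 by rewrite divr_gt0.
by rewrite mxscale_split; exact: lv.
Qed.

(** Compression sends the unit to some [w], which is dominated by [c] times the unit. Perturbing [v]
    by [r / c] before compressing therefore costs at most [r] afterwards. *)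
Lemma lambda_cone_sandwich n k (A : 'M[C]_(n, k)) v :
  lcone n v -> lcone k (mxsandwich (adjmx A) v A).
Proof.
move=> lv r r0; pose w := mxsandwich (adjmx A) (one n) A.
have pw : pcone k w.
  rewrite /w -{2}[A]adjmxK; apply: pre_cone_sandwich.
  by rewrite -[one n]mxscale1; apply: (@pre_cone_one n 1); exact: ler01.
(* The involution of [tens_system] is the same for all families of cones; the empty one serves
   here. *)
have [c c0 pc] := bounded_self_adjoint (pre_cone_star lamO1 (fun=> set0) pw).
have rc0 : 0 < r / c by rewrite divr_gt0.
have -> : mxscale r%:C (one k) + mxsandwich (adjmx A) v A =
    mxscale (r / c)%:C (mxscale c%:C (one k) - w)
    + mxsandwich (adjmx A) (mxscale (r / c)%:C (one n) + v) A.
  rewrite mxsandwichD mxsandwich_scale -/w mxscaleDr mxscaleN mxscaleC divfK ?gt_eqF//.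
  exact/esym/subrKA.
apply: pD; first by apply: pZ => //; exact: ltW.
by rewrite -{2}[A]adjmxK; apply: pre_cone_sandwich; exact: lv.
Qed.

End LambdaCone.

(** * Tensor products of unital completely positive maps *)

Section PositiveMatrices.
Variable R : realType.
Local Notation C := R[i].

Lemma posmx_conj n m (A : 'M[C]_n) (B : 'M[C]_(m, n)) :
  posmx A -> posmx (B *m A *m adjmx B).
Proof.
move=> [sA pA]; split; first by rewrite !adjmxM adjmxK sA mulmxA.
by move=> x; have := pA (adjmx B *m x); rewrite adjmxM adjmxK !mulmxA.
Qed.

Lemma posmx_limit n (A : 'M[C]_n) :
  (forall r : R, 0 < r -> posmx (r%:C%:M + A)) -> posmx A.
Proof.
move=> pA; split.
  have [+ _] := pA 1 ltr01; rewrite adjmxD adjmx_scalar conjcR.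
  exact: addrI.
move=> x; pose c := (adjmx x *m x) 0 0.
have cE r : (adjmx x *m (r%:C%:M + A) *m x) 0 0 = r%:C * c + (adjmx x *m A *m x) 0 0.
  by rewrite mulmxDr mulmxDl mxE mul_mx_scalar -scalemxAl [in LHS]mxE.
have c0 : 0 <= c.
  rewrite /c mxE; apply: sumr_ge0 => i _; rewrite adjmxE mulrC.
  exact: mulcJ_ge0.
have ge0 r : 0 < r -> 0 <= r%:C * c + (adjmx x *m A *m x) 0 0.
  by move=> r0; rewrite -cE; have [_] := pA r r0; apply.
move: ge0; case: (_ 0 0) => a b; move: c0; rewrite lecE.
case: c {cE} => c d /= /andP[/eqP -> c0] ge0.
have b0 : b = 0.
  by have /ger0_Im /= := ge0 1 ltr01; rewrite mulr0 mul0r !addr0 add0r.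
rewrite lecE /= b0 eqxx /= leNgt; apply/negP => a0.
have c10 : 0 < c + 1 by rewrite ltr_wpDl.
(* If the form had the value [a < 0], this perturbation would give [a / (c + 1) < 0]; the summand 1
   covers [c = 0]. *)
have := ge0 (- a / (c + 1)); rewrite divr_gt0 ?oppr_gt0// => /(_ isT).
rewrite lecE /= => /andP[_]; rewrite mul0r subr0.
have -> : - a / (c + 1) * c + a = a / (c + 1) by field; rewrite gt_eqF.
by rewrite leNgt pmulr_llt0 ?invr_gt0// a0.
Qed.

(** The quadratic form vanishes. Polarizing at [x + y] and at [x + 'i y] gives [B x y = - B y x] and
    [B x y = B y x]. *)
Lemma posmx_anti n (A : 'M[C]_n) : posmx A -> posmx (- A) -> A = 0.
Proof.
move=> [_ pA] [_ nA].
pose B (x y : 'cV[C]_n) := (adjmx x *m A *m y) 0 0.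
have q0 x : B x x = 0.
  apply/eqP; rewrite eq_le [0 <= _]pA andbT -oppr_ge0.
  by have := nA x; rewrite mulmxN mulNmx mxE.
have Bl x y z : B (x + y) z = B x z + B y z by rewrite /B adjmxD !mulmxDl mxE.
have Br x y z : B x (y + z) = B x y + B x z by rewrite /B mulmxDr mxE.
have Blz a x z : B (a *: x) z = a^*%C * B x z by rewrite /B adjmxZ -!scalemxAl mxE.
have Brz a x z : B x (a *: z) = a * B x z by rewrite /B -scalemxAr mxE.
have anti x y : B x y + B y x = 0.
  by have := q0 (x + y); rewrite Bl !Br !q0 add0r addr0.
have B0 x y : B x y = 0.
  have := anti x ('i *: y); rewrite Blz Brz.
  have -> : ('i^*)%C = - 'i :> C by apply/eqP; rewrite eq_complex /= oppr0 !eqxx.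
  rewrite mulNr -mulrBr => /eqP; rewrite mulf_eq0 eq_complex /= oner_eq0 andbF /=.
  rewrite subr_eq0 => /eqP xy; have := anti x y; rewrite -xy -mulr2n => /eqP.
  by rewrite -mulr_natl mulf_eq0 pnatr_eq0 => /eqP.
apply/matrixP => i j; have := B0 (delta_mx i 0) (delta_mx j 0).
by rewrite /B adjmx_delta -rowE -colE !mxE.
Qed.

Lemma flatten_mx_matens n k (A : 'M[C]_n) (B : 'M[C]_k) :
  flatten_mx (matens A B) = A *t B.
Proof. by apply/matrixP => i j; rewrite !mxE. Qed.

Lemma flatten_mxD n k (v w : 'M['M[C]_k]_n) :
  flatten_mx (v + w) = flatten_mx v + flatten_mx w.
Proof. by apply/matrixP => i j; rewrite !mxE. Qed.

Lemma flatten_mxsandwich n m k (A : 'M[C]_(m, n)) (v : 'M['M[C]_k]_n) :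
  flatten_mx (mxsandwich A v (adjmx A)) =
  (A *t 1%:M) *m flatten_mx v *m adjmx (A *t (1%:M : 'M_k)).
Proof.
have -> : adjmx (A *t (1%:M : 'M_k)) = adjmx A *t (1%:M : 'M_k).
  apply/matrixP => i j; rewrite !(adjmxE, mxE) rmorphM; congr (_ * _).
  by rewrite rmorph_nat eq_sym.
move: v; apply: additive_ext => [v w|v w|B x].
- by rewrite mxsandwichD flatten_mxD.
- by rewrite flatten_mxD mulmxDr mulmxDl.
by rewrite mxsandwich_matens !flatten_mx_matens !tensmx_mul mul1mx mulmx1.
Qed.

Lemma tensmx11 k l : (1%:M : 'M[C]_k) *t (1%:M : 'M[C]_l) = 1%:M.
Proof.
apply/matrixP => x y; case: (mxtens_indexP x) => a b; case: (mxtens_indexP y) => c d.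
rewrite tensmxE !mxE (can_eq (@mxtens_indexK _ _)) xpair_eqE.
by rewrite -natrM mulnb.
Qed.

End PositiveMatrices.

Section TensorMaps.
Variables (R : realType) (tau : nat -> nat)
  (lam : forall k, {bilinear 'M[R[i]]_k -> 'M[R[i]]_k -> 'M[R[i]]_(tau k)}).
Variables S T : operator_system R.
Local Notation C := R[i].
Local Notation pcone n := (@pre_cone R tau lam S T n).
Local Notation lcone n := (@lambda_cone R tau lam S T n).

Hypothesis lamO3 : condO3 lam.

Variables (k l : nat) (phi : S -> mx_system R k) (psi : T -> mx_system R l).
Hypotheses (k0 : (0 < k)%N) (l0 : (0 < l)%N).
Hypotheses (phi_ucp : is_ucp phi) (psi_ucp : is_ucp psi).

Definition tensor_map : tensor S T -> 'M[C]_(k * l) :=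
  tens_lift (fun s t => phi s *t psi t).

Lemma tensor_map_bilinear :
  bilinear_for *:%R *:%R (fun s t => phi s *t psi t : 'M[C]_(k * l)).
Proof.
have [phil _ _] := phi_ucp; have [psil _ _] := psi_ucp.
split=> [t a x y|s a x y]; apply/matrixP => i j; rewrite ?(phil, psil) !mxE.
  by rewrite mulrDl mulrA.
by rewrite mulrDr mulrCA.
Qed.

Let kron : {bilinear S -> T -> 'M[C]_(k * l)} :=
  HB.pack (fun s t => phi s *t psi t : 'M[C]_(k * l))
    (bilinear_isBilinear.Build C S T 'M[C]_(k * l) *:%R *:%R _ tensor_map_bilinear).

Lemma tensor_map_linear : linear tensor_map.
Proof. exact: (tens_lift_linear kron). Qed.

Lemma tensor_mapN u : tensor_map (- u) = - tensor_map u.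
Proof.
pose f : {linear tensor S T -> 'M[C]_(k * l)} :=
  HB.pack tensor_map (GRing.isLinear.Build _ _ _ _ _ tensor_map_linear).
exact: (linearN f).
Qed.

Lemma tensor_mapE s t : tensor_map (tens s t) = phi s *t psi t.
Proof.
apply: (tens_liftE (f := kron)) => [v v' w|v w w'|a v w].
- by rewrite linearDl.
- by rewrite linearDr.
- by rewrite linearZl_LR linearZr_LR.
Qed.

Lemma tensor_map_amplify n (s : 'M[S]_n) (t : 'M[T]_n) :
  map_mx tensor_map (amplify (lam n) (@tens C S T) s t) =
  amplify (lam n) (fun a b => a *t b : 'M[C]_(k * l)) (map_mx phi s) (map_mx psi t).
Proof.
pose f : {linear tensor S T -> 'M[C]_(k * l)} :=
  HB.pack tensor_map (GRing.isLinear.Build _ _ _ _ _ tensor_map_linear).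
have fE : tensor_map =1 f by [].
apply/matrixP => x y; rewrite !mxE fE.
do 4 ![rewrite linear_sum; apply: eq_bigr => ? _].
by rewrite linearZ /= tensor_mapE !mxE.
Qed.

(** The map carries the amplification of [s] and [t] to the Kronecker amplification of their images
    under [phi] and [psi], which (O3) makes positive. *)
Lemma posmx_pre_cone n v : pcone n v -> posmx (flatten_mx (map_mx tensor_map v)).
Proof.
move=> [j [s [t [a [j0 ps pt ->]]]]].
have [_ _ phip] := phi_ucp; have [_ _ psip] := psi_ucp.
rewrite map_mxsandwich; last exact: tensor_map_linear.
rewrite flatten_mxsandwich tensor_map_amplify; apply: posmx_conj.
by apply: lamO3 => //; [exact: phip|exact: psip].
Qed.

(** Unitality turns the perturbation by [r] units into [r] times the identity matrix, so
    [posmx_limit] applies. *)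
Lemma posmx_lambda_cone n v : lcone n v -> posmx (flatten_mx (map_mx tensor_map v)).
Proof.
have [_ phi1 _] := phi_ucp; have [_ psi1 _] := psi_ucp.
pose f : {linear tensor S T -> 'M[C]_(k * l)} :=
  HB.pack tensor_map (GRing.isLinear.Build _ _ _ _ _ tensor_map_linear).
have fE : tensor_map =1 f by [].
have f1 : flatten_mx (map_mx tensor_map
    (diag_cst n (tens (sys_unit S) (sys_unit T)))) = 1%:M.
  have mE z : map_mx tensor_map (matens (1%:M : 'M_n) z) = matens 1%:M (tensor_map z).
    by apply/matrixP => i j; rewrite !mxE !fE linearZ.
  by rewrite diag_cst_matens mE flatten_mx_matens tensor_mapE phi1 psi1 /= !tensmx11.
move=> lv; apply: posmx_limit => r /lv /posmx_pre_cone.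
congr posmx; apply/matrixP => x y; rewrite !mxE fE linearD linearZ -!fE !mxE.
congr (_ + _); move/matrixP/(_ x y): f1; rewrite !mxE => ->.
by rewrite mulr_natr.
Qed.

Lemma tensor_map_ucp :
  @is_ucp R (tens_system (@lambda_cone R tau lam S T)) (mx_system R (k * l)) tensor_map.
Proof.
have [_ phi1 _] := phi_ucp; have [_ psi1 _] := psi_ucp.
split; [exact: tensor_map_linear| |move=> n v _; exact: posmx_lambda_cone].
by rewrite tensor_mapE phi1 psi1; exact: tensmx11.
Qed.

End TensorMaps.

(** * Separation by product states *)

Lemma state_ucp (R : realType) (X : operator_system R) (f : X -> R[i]) : is_state f ->
  @is_ucp R X (mx_system R 1) (fun x => (f x)%:M).
Proof.
move=> sf; have [fl f1 fp] := sf; split=> [a x y||n v n0 cv]; rewrite ?f1//.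
  by rewrite fl; apply/matrixP => i j; rewrite !mxE !ord1 !eqxx !mulr1n.
have [_ [vstar _ _] _] := operator_systemP X.
have vE := vstar _ _ n0 cv.
split.
  apply/matrixP => i j; rewrite adjmxE !mxE rmorphMn !ord1 !eqxx /=.
  by rewrite -(state_star sf) -[in RHS]vE mxE.
(* [y] is [x] reindexed from [n * 1] to [n]; the quadratic form of the image at [x] is [f] of the
   compression of [v] by [y]. *)
move=> x; pose y : 'cV[R[i]]_n := \col_p x (mxtens_index (p, 0)) 0.
have py : pos1 (mxsandwich (adjmx y) v y 0 0).
  rewrite /pos1.
  have -> : const_mx (mxsandwich (adjmx y) v y 0 0) = mxsandwich (adjmx y) v y.
    by apply/matrixP => i j; rewrite mxE !ord1.
  by rewrite -{2}[y]adjmxK; exact: cone_sandwich.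
have sumE (F : 'I_(n * 1) -> R[i]) : \sum_q F q = \sum_(p < n) F (mxtens_index (p, 0)).
  rewrite (reindex (fun p : 'I_n => mxtens_index (p, 0 : 'I_1)))//.
  exists (fun q => (mxtens_unindex q).1) => [p _|q _]; first by rewrite mxtens_indexK.
  by case: (mxtens_indexP q) => p o; rewrite mxtens_indexK /= !ord1.
have fsum (I : finType) (F : I -> X) : f (\sum_i F i) = \sum_i f (F i).
  by apply: big_morph; [exact: stateD|exact: state0].
have := fp _ py; congr (0 <= _).
rewrite mxsandwichE fsum mxE sumE.
under eq_bigr => q _ do rewrite fsum.
rewrite exchange_big /=; apply: eq_bigr => q _.
rewrite [(_ *m _) _ _]mxE sumE mulr_suml; apply: eq_bigr => p _.
by rewrite (stateZ sf) !mxE !mxtens_indexK /= mulr1n mulrAC.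
Qed.

(** Induction on the number of terms. For the first term [(x, y)] and a state [g0] with [g0 y != 0],
    the hypothesis at [g0] and separation in [S] express [x] by the other left factors. Substituting
    this moves multiples of [y] into the other right factors and leaves one term fewer. *)
Lemma states_separate_sums (R : realType) (S T : operator_system R) (u : seq (S * T)) :
  (forall f g, is_state f -> is_state g -> \sum_(p <- u) f p.1 * g p.2 = 0) ->
  \sum_(p <- u) tens p.1 p.2 = 0.
Proof.
have [m] := ubnP (size u); elim: m u => // m IH [|[x y] u] /=; first by rewrite big_nil.
rewrite ltnS => um u0; rewrite big_cons /=.
have [y0|yn0] := eqVneq y 0.
  rewrite y0 linear0r add0r; apply: IH => // f g sf sg.
  by have := u0 f g sf sg; rewrite big_cons /= y0 (state0 sg) mulr0 add0r.
have [g0 sg0 gy] := exists_state yn0.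
pose c (p : S * T) := g0 p.2 / g0 y.
have fsum (X : operator_system R) (f : X -> R[i]) (F : S * T -> X) : is_state f ->
    f (\sum_(p <- u) F p) = \sum_(p <- u) f (F p).
  by move=> sf; apply: big_morph; [exact: stateD|exact: state0].
have xE : x + \sum_(p <- u) c p *: p.1 = 0.
  apply/eqP; apply: contraT => /exists_state[f sf].
  rewrite (stateD sf) (fsum _ _ _ sf) => /eqP[].
  apply: (mulIf gy); rewrite mul0r -[RHS](u0 f g0 sf sg0) big_cons mulrDl; congr (_ + _).
  rewrite mulr_suml; apply: eq_bigr => p _.
  by rewrite (stateZ sf) mulrAC divfK// mulrC.
have {}xE : x = - \sum_(p <- u) c p *: p.1 by apply/eqP; rewrite -addr_eq0 xE.
rewrite [in LHS]xE.
rewrite linearNl linear_sumlz -sumrN -big_split /=.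
pose u' := [seq (p.1, p.2 - c p *: y) | p <- u].
transitivity (\sum_(p <- u') tens p.1 p.2).
  rewrite big_map; apply: eq_bigr => p _ /=.
  by rewrite linearBr addrC linearZl_LR linearZr_LR.
apply: IH => [|f g sf sg]; first by rewrite size_map.
rewrite big_map /= -[RHS](u0 f g sf sg) big_cons /= xE.
rewrite -scaleN1r (stateZ sf) (fsum _ _ _ sf) mulN1r mulNr mulr_suml -sumrN -big_split.
apply: eq_bigr => p _ /=.
rewrite (stateD sg) -scaleN1r !(stateZ sg) (stateZ sf) mulN1r mulrDr addrC.
by rewrite mulrN mulrCA mulrA.
Qed.

(** * The operator system on the tensor product *)

Section TensorProductSystem.
Variables (R : realType) (tau : nat -> nat)
  (lam : forall k, {bilinear 'M[R[i]]_k -> 'M[R[i]]_k -> 'M[R[i]]_(tau k)}).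
Variables S T : operator_system R.
Hypothesis lamO3 : condO3 lam.

(** States are completely positive, so their products send [v] and [- v] to positive scalar
    matrices, hence to 0; product states separate the entries of [v]. *)
Lemma lambda_cone_anti n (v : 'M[tensor S T]_n) :
  lambda_cone lam v -> lambda_cone lam (- v) -> v = 0.
Proof.
move=> lv lNv; apply/matrixP => i j; rewrite [RHS]mxE [LHS]tensE.
apply: states_separate_sums => f g sf sg.
have uf := state_ucp sf; have ug := state_ucp sg.
have pv := posmx_lambda_cone lamO3 (ltn0Sn 0) (ltn0Sn 0) uf ug lv.
have := posmx_lambda_cone lamO3 (ltn0Sn 0) (ltn0Sn 0) uf ug lNv.
set F := tensor_map _ _ in pv *.
have -> : flatten_mx (map_mx F (- v)) = - flatten_mx (map_mx F v).
  by apply/matrixP => x y; rewrite !mxE /F tensor_mapN// mxE.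
move/(posmx_anti pv)/matrixP/(_ (mxtens_index (i, 0)) (mxtens_index (j, 0))).
rewrite !mxE !mxtens_indexK /= /F /tensor_map /tens_lift summxE => E.
by rewrite -[RHS]E; apply: eq_bigr => p _; rewrite !mxE !ord1.
Qed.

Hypotheses (lamN1 : condN1 tau) (lamE2 : condE2 lam)
  (lam1 : lam 1 1%:M 1%:M = 1%:M) (lamO1 : condO1 lam) (lamO2 : condO2 lam).

Lemma lambda_operator_system :
  is_operator_system (tens_system (@lambda_cone R tau lam S T)).
Proof.
split; first exact: tens_system_involution.
  split=> [n v _|n n0|n k A v _ _].
  - exact: lambda_cone_star.
  - split=> [|v w|r v|v].
    + by apply: pre_cone_lambda => //; exact: pre_cone0.
    + exact: lambda_coneD.
    + exact: lambda_coneZ.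
    + exact: lambda_cone_anti.
  - exact: lambda_cone_sandwich.
split=> [|n v _ vE|n v _ _].
- by rewrite tens_starE !sys_star_unit.
- have [r r0 pr] := bounded_self_adjoint lamN1 lamE2 lam1 vE.
  by exists r => //; exact: pre_cone_lambda.
- exact: lambda_cone_archimedean.
Qed.

End TensorProductSystem.

Theorem theorem4p3 (R : realType) (tau : nat -> nat)
    (lam : forall k,
       {bilinear 'M[R[i]]_k -> 'M[R[i]]_k -> 'M[R[i]]_(tau k)}) :
  standing_conditions lam -> condO1 lam -> condO2 lam -> condO3 lam ->
  operator_system_tensor_product (lambda_cone lam).
Proof.
move=> [_ lamN1 _ _ lamE2 [lam1 _] _ _] lamO1 lamO2 lamO3 S T; split.
- exact: lambda_operator_system.
- move=> k l P Q k0 l0 cP cQ; apply: pre_cone_lambda => //.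
  exact: pre_cone_tensmx.
- move=> k l phi psi k0 l0 phi_ucp psi_ucp; exact: tensor_map_ucp.
Qed.
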